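(* Let $[\mathrm{GV}]_{\beta,0}$ denote the genus zero Gopakumar-Vafa invariants of a Calabi-Yau threefold. With $\check\lambda=\lambda/2\pi$, the non-perturbative corrections to the topological string $$Z_{top,sg}(\lambda,t):=\prod_{\beta>0}\prod_{m=0}^\infty\exp\left(-\frac{[\mathrm{GV}]_{\beta,0}}{2\pi i}\mathrm{Li}_2(Q'^\beta q'^m)\right)\cdot(1-Q'^\beta q'^m)^{-\frac{[\mathrm{GV}]_{\beta,0}}{\check\lambda}(t^\beta+m)}$$ can be expressed as $Z_{top,sg}(\lambda,t)=\exp(F_{top,sg}(\lambda,t))$, where $$F_{top,sg}(\lambda,t)=-\frac1{2\pi}\,\partial_\lambda\left(\lambda\,\tilde F^0_{\mathrm{def}}\left(\frac{2\pi}{\check\lambda},\frac{t-1/2}{\check\lambda}\right)\right),\qquad \tilde F^0_{\mathrm{def}}(\varepsilon,t):=\frac12\sum_{\beta>0}\sum_{k=1}^\infty\frac{[\mathrm{GV}]_{\beta,0}}{k^2}\frac{Q^{k\beta}}{\sin(k\varepsilon/2)}.$$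
   Context: $q'=e^{2\pi i/\check\lambda}$, $Q^\beta=e^{2\pi i t^\beta}$, $Q^{k\beta}=e^{2\pi i k t^\beta}$, $Q'^\beta=e^{2\pi i t^\beta/\check\lambda}$, $\mathrm{Li}_2(z)=\sum_{k\ge1}z^k/k^2$. $\beta>0$ ranges over non-constant curve classes; the $t^\beta$ are treated as independent variables, one for each class, and $t$ denotes their collection. Evaluating $\tilde F^0_{\mathrm{def}}$ at second argument $(t-1/2)/\check\lambda$ means replacing each $t^\beta$ by $(t^\beta-1/2)/\check\lambda$, i.e. $Q^{k\beta}$ by $e^{2\pi i k(t^\beta-1/2)/\check\lambda}$. $\partial_\lambda$ is taken with all $t^\beta$ fixed. The function $\tilde F^0_{\mathrm{def}}$ is an $\varepsilon$-deformation of the non-classical part $\tilde F^0(t)=\sum_{\beta>0}[\mathrm{GV}]_{\beta,0}\sum_{k\ge1}Q^{k\beta}/k^3$ of the prepotential. *)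

(* Defs.v *)
From Stdlib Require Import Reals List ZArith.
From Coquelicot Require Import Coquelicot.

Open Scope C_scope.

Definition Cexp (z : C) : C := (exp (Re z) * cos (Im z), exp (Re z) * sin (Im z))%R.

Definition Csin (z : C) : C := (Cexp (Ci * z) - Cexp (- (Ci * z))) / (2 * Ci).

(* Principal argument, in (-PI, PI]; meaningful for z <> 0 only. *)
Definition Carg (z : C) : R :=
  if Rle_dec 0 (Im z) then acos (Re z / Cmod z)%R else (- acos (Re z / Cmod z))%R.

Definition Clog (z : C) : C := (ln (Cmod z), Carg z).

(* z ^ a, taken on the principal branch *)
Definition Cpower (z a : C) : C := Cexp (a * Clog z).

Definition Ce (z : C) : C := Cexp (2 * RtoC PI * Ci * z).

(* Total operators: their value is unspecified when the limit does not exist. *)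
Definition Clim_along {T : Type} (F : (T -> Prop) -> Prop) (f : T -> C) : C :=
  iota (T := C_CompleteNormedModule)
    (fun l : C => filterlim f F (locally (T := C_UniformSpace) l)).

Definition ex_Clim_along {T : Type} (F : (T -> Prop) -> Prop) (f : T -> C) : Prop :=
  exists l : C, filterlim f F (locally (T := C_UniformSpace) l).

Fixpoint Cprod_upto (a : nat -> C) (n : nat) : C :=
  match n with O => 1 | S p => Cprod_upto a p * a p end.

Definition CSeries (a : nat -> C) : C :=
  iota (T := C_CompleteNormedModule) (fun l : C => is_series (V := C_NormedModule) a l).
Definition CProd (a : nat -> C) : C := Clim_along eventually (Cprod_upto a).
Definition ex_CProd (a : nat -> C) : Prop := ex_Clim_along eventually (Cprod_upto a).

(* Finite subsets of B, as duplicate-free lists, directed by inclusion.  Limits along this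
   filter are unordered (unconditional) sums and products over B. *)
Definition finsets (B : Type) : (list B -> Prop) -> Prop :=
  fun P => exists s : list B, forall l : list B, NoDup l -> incl s l -> P l.

Definition Csum_list {B : Type} (f : B -> C) (l : list B) : C :=
  fold_right Cplus 0 (map f l).
Definition Cprod_list {B : Type} (f : B -> C) (l : list B) : C :=
  fold_right Cmult 1 (map f l).

Definition CSum_over {B : Type} (f : B -> C) : C := Clim_along (finsets B) (Csum_list f).
Definition ex_CSum_over {B : Type} (f : B -> C) : Prop :=
  ex_Clim_along (finsets B) (Csum_list f).
Definition CProd_over {B : Type} (f : B -> C) : C := Clim_along (finsets B) (Cprod_list f).
Definition ex_CProd_over {B : Type} (f : B -> C) : Prop :=
  ex_Clim_along (finsets B) (Cprod_list f).

Definition abs_summable {B : Type} (f : B -> C) : Prop :=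
  exists M : R, forall l : list B, NoDup l ->
    (fold_right Rplus 0 (map (fun b => Cmod (f b)) l) <= M)%R.

Definition Li2 (z : C) : C :=
  CSeries (fun n => z ^ (S n) / RtoC (INR (S n)) ^ 2).

(* Conventions for the parameters below:
   B is the set of non-constant curve classes, GV b the genus zero Gopakumar-Vafa
   invariant of the class b, and t b the independent variable attached to b. *)

Definition lambda_check (lambda : C) : C := lambda / (2 * RtoC PI).

Definition q' (lambda : C) : C := Ce (1 / lambda_check lambda).

Definition Q' {B : Type} (lambda : C) (t : B -> C) (b : B) : C :=
  Ce (t b / lambda_check lambda).

Definition Z_factor {B : Type} (GV : B -> Z) (lambda : C) (t : B -> C) (b : B) (m : nat) : C :=
  let x := Q' lambda t b * q' lambda ^ m in
  Cexp (- (RtoC (IZR (GV b)) / (2 * RtoC PI * Ci)) * Li2 x)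
  * Cpower (1 - x)
      (- (RtoC (IZR (GV b)) / lambda_check lambda) * (t b + RtoC (INR m))).

Definition Z_top_sg {B : Type} (GV : B -> Z) (lambda : C) (t : B -> C) : C :=
  CProd_over (fun b => CProd (Z_factor GV lambda t b)).

(* The summand with index n is the term k = n + 1. *)
Definition F0_def_term {B : Type} (GV : B -> Z) (epsilon : C) (t : B -> C)
    (b : B) (n : nat) : C :=
  let k := RtoC (INR (S n)) in
  RtoC (IZR (GV b)) / k ^ 2 * (Ce (k * t b) / Csin (k * epsilon / 2)).

Definition F0_def {B : Type} (GV : B -> Z) (epsilon : C) (t : B -> C) : C :=
  1 / 2 * CSum_over (fun b => CSeries (F0_def_term GV epsilon t b)).

Definition dual_epsilon (lambda : C) : C := 2 * RtoC PI / lambda_check lambda.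

Definition dual_t {B : Type} (lambda : C) (t : B -> C) : B -> C :=
  fun b => (t b - 1 / 2) / lambda_check lambda.

Definition lambda_F0_def {B : Type} (GV : B -> Z) (t : B -> C) (lambda : C) : C :=
  lambda * F0_def GV (dual_epsilon lambda) (dual_t lambda t).

Definition F_top_sg {B : Type} (GV : B -> Z) (lambda : C) (t : B -> C) : C :=
  - (1 / (2 * RtoC PI)) * C_derive (lambda_F0_def GV t) lambda.

(* Main.v *)
Require Import Defs.
From Stdlib Require Import Reals List ZArith Permutation Classical Lra Lia.
From Coquelicot Require Import Coquelicot.
Local Open Scope C_scope.

(* In the variable w = 1 / lambda, expanding 1 / (1 - q'^k) turns the dual prepotential into
   -2i times the sum over (b, m, k) of GV_b / k^2 * (Q'^b q'^m)^k, and each summand is a constant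
   times an exponential e^(s w).  Absolute summability of such a sum on a disc around w, needed only
   at four points of it, gives absolute convergence with a factor e^(rho |s|) to spare, hence
   termwise differentiability at w.  Reordering the differentiated sum, with k innermost, produces
   Li_2 and the principal logarithm, i.e. the logarithms of the factors of Z. *)

(** * Unordered sums *)

(** The obstacle is that differentiating in lambda brings down a factor [t b], and the [t b] are
    unrelated variables that may be unbounded: summability of [GV b * Q'^b] at lambda alone says
    nothing about [GV b * t b * Q'^b]. This is why the summability hypothesis is local in lambda.

    With w = 1 / lambda and G the triple sum, lambda G(1 / lambda) has derivative G - w G'. On a
    summand GV_b / k^2 * x^k with x = Q'^b q'^m, the part G keeps 1 / k^2 and sums to the
    dilogarithm, while the frequency in w G' carries a factor k (t_b + m), which leaves 1 / k and
    sums to the logarithm with the exponent t_b + m of the product.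

    One absolutely summable family over triples thus yields every series and product in the
    statement. Products are obtained by applying [Cexp] to unordered sums, so a logarithm of an
    infinite product is never chosen. *)

Lemma locally_Cmod (z : C) (P : C -> Prop) :
  locally (T := C_UniformSpace) z P <->
  exists d : R, (0 < d)%R /\ forall y : C, (Cmod (y - z) < d)%R -> P y.
Proof.
  split.
  - intros [d Hd]. exists d. split; [apply cond_pos|].
    intros y Hy. apply Hd. apply C_NormedModule_mixin_compat1. exact Hy.
  - intros [d [Hd H]].
    (* Balls of [C_UniformSpace] are squares; passing from a square to the modulus costs a factor
       sqrt 2. *)
    assert (Hd2 : (0 < d / sqrt 2)%R) by (apply Rdiv_lt_0_compat; [lra|apply Rlt_sqrt2_0]).
    exists (mkposreal _ Hd2). intros y Hy. apply H.
    apply C_NormedModule_mixin_compat2 in Hy. simpl in Hy.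
    replace (sqrt 2 * (d / sqrt 2))%R with d in Hy; [exact Hy|].
    field. apply Rgt_not_eq, Rlt_sqrt2_0.
Qed.

Lemma filterlim_Cmod {T : Type} (F : (T -> Prop) -> Prop) {FF : Filter F} (f : T -> C) (z : C) :
  filterlim f F (locally (T := C_UniformSpace) z) <->
  forall eps : R, (0 < eps)%R -> F (fun x => (Cmod (f x - z) < eps)%R).
Proof.
  split.
  - intros H eps Heps. apply (H (fun y => (Cmod (y - z) < eps)%R)).
    apply locally_Cmod. exists eps. auto.
  - intros H P HP. apply locally_Cmod in HP. destruct HP as [d [Hd HP]].
    unfold filtermap. apply filter_imp with (2 := H d Hd). auto.
Qed.

(** No equality test is available on an arbitrary index type, so duplicates are removed by classical
    case distinction on membership. *)
Lemma NoDup_support {I : Type} (l : list I) :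
  exists l', NoDup l' /\ forall x, In x l' <-> In x l.
Proof.
  induction l as [|a l [l' [H1 H2]]].
  - exists nil. split; [constructor|tauto].
  - destruct (classic (In a l')) as [Ha|Ha].
    + exists l'. split; [exact H1|]. intros x. simpl. rewrite H2.
      split; [tauto|]. intros [<-|H]; [apply H2, Ha|exact H].
    + exists (a :: l'). split; [constructor; assumption|].
      intros x. simpl. rewrite H2. tauto.
Qed.

Global Instance finsets_proper (I : Type) : ProperFilter (finsets I).
Proof.
  constructor.
  - intros P [s Hs]. destruct (NoDup_support s) as [s' [H1 H2]].
    exists s'. apply Hs; [exact H1|]. intros x. apply H2.
  - constructor.
    + exists nil. auto.
    + intros P Q [s Hs] [s' Hs']. exists (s ++ s'). intros l Hl Hi.
      split; [apply Hs|apply Hs']; auto; intros x Hx; apply Hi, in_or_app; auto.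
    + intros P Q H [s Hs]. exists s. auto.
Qed.

(** Here [r] stands for the difference of [l] and [s], which cannot be computed without decidable
    equality. *)
Lemma incl_Permutation_app {I : Type} (s l : list I) :
  NoDup s -> incl s l -> exists r, Permutation l (s ++ r).
Proof.
  induction s as [|a s IH]; intros Hs Hi.
  - exists l. reflexivity.
  - inversion_clear Hs as [|? ? Ha Hs'].
    destruct IH as [r Hr]; [exact Hs'|intros x Hx; apply Hi; now right|].
    assert (Hin : In a (s ++ r)) by (rewrite <- Hr; apply Hi; now left).
    apply in_app_or in Hin. destruct Hin as [Hin|Hin]; [contradiction|].
    apply in_split in Hin. destruct Hin as [r1 [r2 ->]].
    exists (r1 ++ r2). rewrite Hr, !app_assoc. symmetry.
    simpl. rewrite <- app_assoc. rewrite app_assoc. apply Permutation_middle.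
Qed.

Definition Rsum_list {I : Type} (f : I -> R) (l : list I) : R :=
  fold_right Rplus 0%R (map f l).

Definition is_usum {I : Type} (f : I -> C) (S : C) : Prop :=
  filterlim (Csum_list f) (finsets I) (locally (T := C_UniformSpace) S).

Lemma is_usum_eps {I : Type} (f : I -> C) (S : C) :
  is_usum f S <-> forall eps : R, (0 < eps)%R ->
  exists s, forall l, NoDup l -> incl s l -> (Cmod (Csum_list f l - S) < eps)%R.
Proof. apply filterlim_Cmod. typeclasses eauto. Qed.

Section ListSums.
Context {I : Type}.
Implicit Types (l s r : list I).

Lemma Rsum_list_app (f : I -> R) l l' :
  Rsum_list f (l ++ l') = (Rsum_list f l + Rsum_list f l')%R.
Proof.
  unfold Rsum_list. induction l as [|a l IH]; simpl; [ring|rewrite IH; ring].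
Qed.

Lemma Csum_list_app (f : I -> C) l l' :
  Csum_list f (l ++ l') = Csum_list f l + Csum_list f l'.
Proof.
  unfold Csum_list. induction l as [|a l IH]; simpl; [ring|rewrite IH; ring].
Qed.

Lemma Rsum_list_Permutation (f : I -> R) l l' :
  Permutation l l' -> Rsum_list f l = Rsum_list f l'.
Proof.
  unfold Rsum_list. induction 1; simpl; [reflexivity|congruence|ring|congruence].
Qed.

Lemma Csum_list_Permutation (f : I -> C) l l' :
  Permutation l l' -> Csum_list f l = Csum_list f l'.
Proof.
  unfold Csum_list. induction 1; simpl; [reflexivity|congruence|ring|congruence].
Qed.

Lemma Rsum_list_ge0 (f : I -> R) l :
  (forall x, (0 <= f x)%R) -> (0 <= Rsum_list f l)%R.
Proof.
  intros H. unfold Rsum_list. induction l as [|a l IH]; simpl; [lra|].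
  specialize (H a). lra.
Qed.

Lemma Rsum_list_le (f g : I -> R) l :
  (forall x, (f x <= g x)%R) -> (Rsum_list f l <= Rsum_list g l)%R.
Proof.
  intros H. unfold Rsum_list. induction l as [|a l IH]; simpl; [lra|].
  specialize (H a). lra.
Qed.

Lemma Rsum_list_scal (f : I -> R) (k : R) l :
  Rsum_list (fun x => k * f x)%R l = (k * Rsum_list f l)%R.
Proof.
  unfold Rsum_list. induction l as [|a l IH]; simpl; [ring|rewrite IH; ring].
Qed.

Lemma Rsum_list_incl (f : I -> R) s l :
  (forall x, (0 <= f x)%R) -> NoDup s -> incl s l ->
  (Rsum_list f s <= Rsum_list f l)%R.
Proof.
  intros H Hs Hi. destruct (incl_Permutation_app s l Hs Hi) as [r Hr].
  rewrite (Rsum_list_Permutation f _ _ Hr), Rsum_list_app.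
  generalize (Rsum_list_ge0 f r H). lra.
Qed.

Lemma Cmod_Csum_list (f : I -> C) l :
  (Cmod (Csum_list f l) <= Rsum_list (fun x => Cmod (f x)) l)%R.
Proof.
  unfold Csum_list, Rsum_list. induction l as [|a l IH]; simpl.
  - rewrite Cmod_0. lra.
  - eapply Rle_trans; [apply Cmod_triangle|]. lra.
Qed.

Lemma Csum_list_ext (f g : I -> C) l :
  (forall x, In x l -> f x = g x) -> Csum_list f l = Csum_list g l.
Proof.
  intros H. unfold Csum_list. f_equal. apply map_ext_in, H.
Qed.

Lemma Csum_list_plus (f g : I -> C) l :
  Csum_list (fun x => f x + g x) l = Csum_list f l + Csum_list g l.
Proof.
  unfold Csum_list. induction l as [|a l IH]; simpl; [ring|rewrite IH; ring].
Qed.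

Lemma Csum_list_scal (f : I -> C) (k : C) l :
  Csum_list (fun x => k * f x) l = k * Csum_list f l.
Proof.
  unfold Csum_list. induction l as [|a l IH]; simpl; [ring|rewrite IH; ring].
Qed.

(** Choose [s] whose sum of moduli is within [eps] of the supremum of all finite sums: anything
    disjoint from [s] can then add at most [eps]. *)
Lemma abs_summable_tail (f : I -> C) (eps : R) :
  abs_summable f -> (0 < eps)%R ->
  exists s, NoDup s /\ forall r, NoDup (s ++ r) ->
    (Rsum_list (fun x => Cmod (f x)) r <= eps)%R.
Proof.
  intros [M HM] Heps.
  set (E := fun x => exists l, NoDup l /\ x = Rsum_list (fun i => Cmod (f i)) l).
  destruct (completeness E) as [S [HS1 HS2]].
  - exists M. intros x [l [Hl ->]]. apply HM, Hl.
  - exists 0%R, nil. split; [constructor|reflexivity].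
  - destruct (classic (exists s, NoDup s /\
      (S - eps < Rsum_list (fun i => Cmod (f i)) s)%R)) as [[s [Hs Hlt]]|Hn].
    + exists s. split; [exact Hs|]. intros r Hr.
      assert (H : (Rsum_list (fun i => Cmod (f i)) (s ++ r) <= S)%R)
        by (apply HS1; exists (s ++ r); auto).
      rewrite Rsum_list_app in H. lra.
    + exfalso. assert (H : (S <= S - eps)%R); [|lra].
      apply HS2. intros x [l [Hl ->]]. apply Rnot_lt_le. intros Hlt.
      apply Hn. exists l. auto.
Qed.

Lemma Csum_list_tail (f : I -> C) (eps : R) s l :
  NoDup s -> (forall r, NoDup (s ++ r) -> (Rsum_list (fun x => Cmod (f x)) r <= eps)%R) ->
  NoDup l -> incl s l -> (Cmod (Csum_list f l - Csum_list f s) <= eps)%R.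
Proof.
  intros Hs Ht Hl Hi. destruct (incl_Permutation_app s l Hs Hi) as [r Hr].
  rewrite (Csum_list_Permutation f _ _ Hr), Csum_list_app.
  replace (Csum_list f s + Csum_list f r - Csum_list f s) with (Csum_list f r) by ring.
  eapply Rle_trans; [apply Cmod_Csum_list|]. apply Ht.
  apply (Permutation_NoDup Hr Hl).
Qed.

Lemma abs_summable_usum (f : I -> C) : abs_summable f -> exists S, is_usum f S.
Proof.
  intros Hf.
  apply (proj1 (filterlim_locally_cauchy (U := C_CompleteNormedModule)
    (F := finsets I) (Csum_list f))).
  intros eps. pose proof (cond_pos eps) as Heps.
  destruct (abs_summable_tail f (eps / 3) Hf) as [s [Hs Ht]]; [lra|].
  exists (fun l => NoDup l /\ incl s l). split; [exists s; auto|].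
  intros u v [Hu Hu'] [Hv Hv']. apply C_NormedModule_mixin_compat1.
  change (minus (Csum_list f v) (Csum_list f u)) with (Csum_list f v - Csum_list f u).
  pose proof (Csum_list_tail f _ s u Hs Ht Hu Hu') as H1.
  pose proof (Csum_list_tail f _ s v Hs Ht Hv Hv') as H2.
  replace (Csum_list f v - Csum_list f u) with
    ((Csum_list f v - Csum_list f s) + - (Csum_list f u - Csum_list f s)) by ring.
  eapply Rle_lt_trans; [apply Cmod_triangle|]. rewrite Cmod_opp. simpl. lra.
Qed.

Lemma is_usum_ext (f g : I -> C) (S : C) :
  (forall x, f x = g x) -> is_usum f S -> is_usum g S.
Proof.
  intros H. apply filterlim_ext. intros l. apply Csum_list_ext. auto.
Qed.

Lemma is_usum_plus (f g : I -> C) (S S' : C) :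
  is_usum f S -> is_usum g S' -> is_usum (fun x => f x + g x) (S + S').
Proof.
  rewrite !is_usum_eps. intros Hf Hg eps Heps.
  destruct (Hf (eps / 2)%R) as [s Hs]; [lra|]. destruct (Hg (eps / 2)%R) as [s' Hs']; [lra|].
  exists (s ++ s'). intros l Hl Hi. rewrite Csum_list_plus.
  replace (Csum_list f l + Csum_list g l - (S + S')) with
    ((Csum_list f l - S) + (Csum_list g l - S')) by ring.
  eapply Rle_lt_trans; [apply Cmod_triangle|].
  assert (Cmod (Csum_list f l - S) < eps / 2)%R
    by (apply Hs; auto; intros x Hx; apply Hi, in_or_app; auto).
  assert (Cmod (Csum_list g l - S') < eps / 2)%R
    by (apply Hs'; auto; intros x Hx; apply Hi, in_or_app; auto).
  lra.
Qed.

Lemma is_usum_scal (f : I -> C) (k S : C) :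
  is_usum f S -> is_usum (fun x => k * f x) (k * S).
Proof.
  rewrite !is_usum_eps. intros Hf eps Heps. pose proof (Cmod_ge_0 k) as Hk.
  destruct (Hf (eps / (Cmod k + 1))%R) as [s Hs]; [apply Rdiv_lt_0_compat; lra|].
  exists s. intros l Hl Hi. rewrite Csum_list_scal.
  replace (k * Csum_list f l - k * S) with (k * (Csum_list f l - S)) by ring.
  rewrite Cmod_mult. specialize (Hs l Hl Hi).
  pose proof (Cmod_ge_0 (Csum_list f l - S)) as H0.
  apply Rle_lt_trans with ((Cmod k + 1) * Cmod (Csum_list f l - S))%R; [nra|].
  apply Rlt_le_trans with ((Cmod k + 1) * (eps / (Cmod k + 1)))%R.
  - apply Rmult_lt_compat_l; lra.
  - right. field. lra.
Qed.

Lemma is_usum_Cmod_le (f : I -> C) (S : C) (M : R) :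
  is_usum f S -> (forall l, NoDup l -> (Rsum_list (fun x => Cmod (f x)) l <= M)%R) ->
  (Cmod S <= M)%R.
Proof.
  rewrite is_usum_eps. intros Hf HM. apply le_epsilon. intros eps Heps.
  destruct (Hf eps Heps) as [s Hs]. destruct (NoDup_support s) as [l [Hl Hi]].
  specialize (Hs l Hl (fun x => proj2 (Hi x))). specialize (HM l Hl).
  replace S with (Csum_list f l + - (Csum_list f l - S)) by ring.
  eapply Rle_trans; [apply Cmod_triangle|]. rewrite Cmod_opp.
  pose proof (Cmod_Csum_list f l). lra.
Qed.

Lemma abs_summable_le (f g : I -> C) (k : R) :
  (forall x, (Cmod (f x) <= k * Cmod (g x))%R) -> abs_summable g -> abs_summable f.
Proof.
  (* The sign of [k] is not prescribed, and multiplying [HM] requires a nonnegative factor. *)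
  intros H [M HM]. exists (Rmax k 0 * M)%R. intros l Hl.
  eapply Rle_trans; [apply (Rsum_list_le _ (fun x => Rmax k 0 * Cmod (g x))%R)|].
  - intros x. eapply Rle_trans; [apply H|].
    apply Rmult_le_compat_r; [apply Cmod_ge_0|apply Rmax_l].
  - rewrite Rsum_list_scal. apply Rmult_le_compat_l; [apply Rmax_r|apply HM, Hl].
Qed.

(** The summand is the sum of the moduli, not [f + g], so that it dominates both families and can be
    nested, as is done for the four points of a disc. *)
Lemma abs_summable_plus (f g : I -> C) :
  abs_summable f -> abs_summable g ->
  abs_summable (fun x => RtoC (Cmod (f x) + Cmod (g x))).
Proof.
  intros [M HM] [N HN]. exists (M + N)%R. intros l Hl.
  specialize (HM l Hl). specialize (HN l Hl). clear Hl. revert M N HM HN.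
  induction l as [|a l IH]; simpl; intros M N HM HN; [lra|].
  specialize (IH (M - Cmod (f a))%R (N - Cmod (g a))%R).
  rewrite Cmod_R, Rabs_pos_eq.
  - specialize (IH ltac:(lra) ltac:(lra)). lra.
  - pose proof (Cmod_ge_0 (f a)). pose proof (Cmod_ge_0 (g a)). lra.
Qed.

End ListSums.

Lemma Csum_list_map {I J : Type} (h : J -> I) (f : I -> C) (l : list J) :
  Csum_list f (map h l) = Csum_list (fun x => f (h x)) l.
Proof. unfold Csum_list. now rewrite map_map. Qed.

Lemma Rsum_list_map {I J : Type} (h : J -> I) (f : I -> R) (l : list J) :
  Rsum_list f (map h l) = Rsum_list (fun x => f (h x)) l.
Proof. unfold Rsum_list. now rewrite map_map. Qed.

Lemma is_usum_bij {I J : Type} (h : J -> I) (k : I -> J) (f : I -> C) (S : C) :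
  (forall x, k (h x) = x) -> (forall y, h (k y) = y) ->
  is_usum f S -> is_usum (fun x => f (h x)) S.
Proof.
  rewrite !is_usum_eps. intros Hk Hh Hf eps Heps. destruct (Hf eps Heps) as [s Hs].
  exists (map k s). intros l Hl Hi. rewrite <- Csum_list_map. apply Hs.
  - apply FinFun.Injective_map_NoDup; [|exact Hl]. intros x y Hxy.
    now rewrite <- (Hk x), Hxy, Hk.
  - intros y Hy. rewrite <- (Hh y). apply in_map, Hi, in_map, Hy.
Qed.

Lemma NoDup_list_prod {I J : Type} (l : list I) (m : list J) :
  NoDup l -> NoDup m -> NoDup (list_prod l m).
Proof.
  intros Hl Hm. induction Hl as [|a l Ha Hl IH]; simpl; [constructor|].
  apply NoDup_app.
  - apply FinFun.Injective_map_NoDup; [|exact Hm]. intros x y H. congruence.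
  - exact IH.
  - intros [x y] H1 H2. apply in_map_iff in H1. destruct H1 as [z [H1 _]].
    apply in_prod_iff in H2. destruct H2 as [H2 _]. congruence.
Qed.

Lemma Csum_list_prod {I J : Type} (f : I * J -> C) (l : list I) (m : list J) :
  Csum_list f (list_prod l m) = Csum_list (fun i => Csum_list (fun j => f (i, j)) m) l.
Proof.
  induction l as [|a l IH]; simpl; [reflexivity|].
  rewrite Csum_list_app, IH, Csum_list_map. reflexivity.
Qed.

Lemma Rsum_list_prod {I J : Type} (f : I -> R) (g : J -> R) (l : list I) (m : list J) :
  Rsum_list (fun p => f (fst p) * g (snd p))%R (list_prod l m) =
  (Rsum_list f l * Rsum_list g m)%R.
Proof.
  induction l as [|a l IH]; simpl; [unfold Rsum_list; simpl; ring|].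
  rewrite Rsum_list_app, IH, Rsum_list_map. simpl. rewrite Rsum_list_scal.
  unfold Rsum_list. simpl. ring.
Qed.

Lemma abs_summable_prod {I J : Type} (f : I -> C) (g : J -> C) :
  abs_summable f -> abs_summable g ->
  abs_summable (fun p : I * J => f (fst p) * g (snd p)).
Proof.
  intros [M HM] [N HN]. exists (M * N)%R. intros l Hl.
  destruct (NoDup_support (map fst l)) as [l1 [H1 H1']].
  destruct (NoDup_support (map snd l)) as [l2 [H2 H2']].
  apply Rle_trans with
    (Rsum_list (fun p => Cmod (f (fst p)) * Cmod (g (snd p)))%R (list_prod l1 l2)).
  - apply Rle_trans with (Rsum_list (fun p => Cmod (f (fst p)) * Cmod (g (snd p)))%R l).
    + apply Rsum_list_le. intros p. rewrite Cmod_mult. lra.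
    + apply Rsum_list_incl; [|exact Hl|].
      * intros p. apply Rmult_le_pos; apply Cmod_ge_0.
      * intros [x y] Hp. apply in_prod; [apply H1'|apply H2'].
        -- apply (in_map fst) in Hp. exact Hp.
        -- apply (in_map snd) in Hp. exact Hp.
  - rewrite (Rsum_list_prod (fun i => Cmod (f i)) (fun j => Cmod (g j))).
    apply Rmult_le_compat;
      [apply Rsum_list_ge0; intros; apply Cmod_ge_0|apply Rsum_list_ge0; intros; apply Cmod_ge_0
      |apply HM, H1|apply HN, H2].
Qed.

(** Let the joint sum be within eps / 2 of [S] beyond the finite set [s], and let [l] contain the
    first components of [s]. For [m] large enough, the rectangle of [l] and [m] contains [s], and
    its rows sum to nearly [g] on [l]. *)
Lemma is_usum_fubini {I J : Type} (f : I * J -> C) (g : I -> C) (S : C) :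
  is_usum f S -> (forall i, is_usum (fun j => f (i, j)) (g i)) ->
  is_usum g S.
Proof.
  intros HS Hg. rewrite is_usum_eps in HS. apply is_usum_eps. intros eps Heps.
  destruct (HS (eps / 2)%R) as [s Hs]; [lra|].
  exists (map fst s). intros l Hl Hi.
  (* The same [m0] has to serve every row of [l]; this is possible because [l] is finite. *)
  assert (Happ : forall e : R, (0 < e)%R -> exists m0 : list J, forall m, NoDup m -> incl m0 m ->
    (Cmod (Csum_list g l - Csum_list (fun i => Csum_list (fun j => f (i, j)) m) l) <= e)%R).
  { clear Hi Hl. induction l as [|a l IH]; intros e He.
    - exists nil. intros. unfold Csum_list; simpl. replace (0 - 0) with (RtoC 0) by ring.
      rewrite Cmod_0. lra.
    - destruct (IH (e / 2)%R) as [m1 H1]; [lra|].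
      specialize (Hg a). rewrite is_usum_eps in Hg.
      destruct (Hg (e / 2)%R) as [m2 H2]; [lra|].
      exists (m1 ++ m2). intros m Hm Hi.
      assert (Hi1 : incl m1 m) by (intros x Hx; apply Hi, in_or_app; auto).
      assert (Hi2 : incl m2 m) by (intros x Hx; apply Hi, in_or_app; auto).
      specialize (H1 m Hm Hi1). specialize (H2 m Hm Hi2).
      unfold Csum_list at 1 2. simpl. fold (Csum_list g l).
      fold (Csum_list (fun i => Csum_list (fun j => f (i, j)) m) l).
      match goal with |- (Cmod ?x <= _)%R => replace x with
        ((Csum_list g l - Csum_list (fun i => Csum_list (fun j => f (i, j)) m) l)
        + - (Csum_list (fun j => f (a, j)) m - g a)) by ring end.
      eapply Rle_trans; [apply Cmod_triangle|]. rewrite Cmod_opp. lra. }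
  destruct (Happ (eps / 2)%R) as [m0 Hm0]; [lra|].
  destruct (NoDup_support (map snd s ++ m0)) as [m [Hm Hm']].
  specialize (Hm0 m Hm (fun x Hx => proj2 (Hm' x) (in_or_app _ _ _ (or_intror Hx)))).
  specialize (Hs (list_prod l m) (NoDup_list_prod l m Hl Hm)).
  rewrite Csum_list_prod in Hs.
  match type of Hm0 with (Cmod (_ - ?y) <= _)%R => set (T := y) in * end.
  replace (Csum_list g l - S) with ((Csum_list g l - T) + (T - S)) by ring.
  eapply Rle_lt_trans; [apply Cmod_triangle|].
  enough (Cmod (T - S) < eps / 2)%R by lra. apply Hs.
  intros [x y] Hp. apply in_prod.
  - apply Hi. apply (in_map fst) in Hp. exact Hp.
  - apply Hm', in_or_app. left. apply (in_map snd) in Hp. exact Hp.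
Qed.

Lemma abs_summable_inj {I J : Type} (h : J -> I) (f : I -> C) :
  (forall x y, h x = h y -> x = y) -> abs_summable f -> abs_summable (fun x => f (h x)).
Proof.
  intros Hh [M HM]. exists M. intros l Hl.
  specialize (HM (map h l) (FinFun.Injective_map_NoDup Hh Hl)).
  rewrite map_map in HM. exact HM.
Qed.

(** Initial segments are cofinal among finite sets of naturals, so unordered convergence implies
    convergence of the ordinary series and products indexed by [nat]. *)
Lemma filterlim_seq : filterlim (seq 0) eventually (finsets nat).
Proof.
  intros P [s Hs]. unfold filtermap.
  assert (Hb : exists N, forall x, In x s -> (x < N)%nat).
  { clear Hs. induction s as [|a s [N HN]]; [exists 0%nat; intros x []|].
    exists (Nat.max N (S a)). intros x [->|Hx]; [lia|]. specialize (HN x Hx). lia. }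
  destruct Hb as [N HN]. exists N. intros n Hn. apply Hs; [apply seq_NoDup|].
  intros x Hx. apply in_seq. specialize (HN x Hx). lia.
Qed.

Lemma Csum_list_seq (f : nat -> C) (n : nat) :
  Csum_list f (seq 0 (S n)) = sum_n (G := C_AbelianMonoid) f n.
Proof.
  induction n as [|n IH].
  - rewrite sum_O. unfold Csum_list. simpl. ring.
  - rewrite seq_S, Csum_list_app, IH, sum_Sn. unfold Csum_list. simpl.
    change (@plus C_AbelianMonoid) with Cplus. ring.
Qed.

Lemma is_usum_series (f : nat -> C) (S : C) :
  is_usum f S -> is_series (V := C_NormedModule) f S.
Proof.
  intros Hf. unfold is_series.
  (* [sum_n f n] includes the index n, hence n + 1 terms. *)
  apply filterlim_ext with (fun n => Csum_list f (seq 0 (Datatypes.S n))).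
  - intros n. apply Csum_list_seq.
  - apply filterlim_comp with (2 := Hf).
    apply (filterlim_comp _ _ _ Datatypes.S (seq 0) _ eventually); [|apply filterlim_seq].
    apply eventually_subseq. intros n. lia.
Qed.

(** A homomorphism from addition to multiplication turns partial sums into partial products, and
    continuity at [S] passes to the limit. It is applied with [F] equal to [Cexp]. *)
Lemma is_usum_Cprod_upto (f : nat -> C) (S : C) (F : C -> C) :
  is_usum f S -> F 0 = 1 -> (forall x y, F (x + y) = F x * F y) ->
  continuous (T := C_UniformSpace) (U := C_UniformSpace) F S ->
  filterlim (Cprod_upto (fun n => F (f n))) eventually (locally (T := C_UniformSpace) (F S)).
Proof.
  intros Hf F0 FD Fc.
  apply filterlim_ext with (fun n => F (Csum_list f (seq 0 n))).
  - intros n. induction n as [|n IH]; [exact F0|].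
    rewrite seq_S, Csum_list_app, FD, IH. simpl. f_equal. f_equal. unfold Csum_list. simpl. ring.
  - apply filterlim_comp with (2 := Fc). apply filterlim_comp with (2 := Hf), filterlim_seq.
Qed.

Lemma is_usum_Cprod_list {I : Type} (f : I -> C) (S : C) (F : C -> C) :
  is_usum f S -> F 0 = 1 -> (forall x y, F (x + y) = F x * F y) ->
  continuous (T := C_UniformSpace) (U := C_UniformSpace) F S ->
  filterlim (Cprod_list (fun n => F (f n))) (finsets I) (locally (T := C_UniformSpace) (F S)).
Proof.
  intros Hf F0 FD Fc.
  apply filterlim_ext with (fun n => F (Csum_list f n)).
  - intros l. unfold Csum_list, Cprod_list. induction l as [|n l IH]; [exact F0|].
    simpl. rewrite FD, IH. reflexivity.
  - apply filterlim_comp with (2 := Fc), Hf.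
Qed.

Lemma CSeries_usum (f : nat -> C) (S : C) : is_usum f S -> CSeries f = S.
Proof.
  intros H. apply (iota_filterlim_locally (V := C_CompleteNormedModule) (F := eventually)). apply is_usum_series, H.
Qed.

Lemma Clim_along_unique {T : Type} (F : (T -> Prop) -> Prop) {FF : ProperFilter F} (f : T -> C) (l : C) :
  filterlim f F (locally (T := C_UniformSpace) l) -> Clim_along F f = l.
Proof.
  intros H. apply (iota_filterlim_locally (V := C_CompleteNormedModule)). exact H.
Qed.

Lemma CSum_over_unique {I : Type} (f : I -> C) (S : C) : is_usum f S -> CSum_over f = S.
Proof. apply Clim_along_unique. typeclasses eauto. Qed.

Lemma CSum_over_correct {I : Type} (f : I -> C) : abs_summable f -> is_usum f (CSum_over f).
Proof.
  intros Hf. destruct (abs_summable_usum f Hf) as [S HS].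
  now rewrite (CSum_over_unique f S HS).
Qed.

Lemma CSum_over_fubini {I J : Type} (f : I * J -> C) : abs_summable f ->
  is_usum (fun i => CSum_over (fun j => f (i, j))) (CSum_over f).
Proof.
  intros Hf. apply (is_usum_fubini f); [now apply CSum_over_correct|].
  intros i. apply CSum_over_correct, (abs_summable_inj (fun j => (i, j))), Hf. congruence.
Qed.

Lemma abs_summable_small {I : Type} (f : I -> C) (eps : R) : abs_summable f -> (0 < eps)%R ->
  exists s, forall i, ~ In i s -> (Cmod (f i) <= eps)%R.
Proof.
  intros Hf Heps. destruct (abs_summable_tail f eps Hf Heps) as [s [Hs Ht]].
  exists s. intros i Hi. specialize (Ht (i :: nil)). unfold Rsum_list in Ht. simpl in Ht.
  rewrite Rplus_0_r in Ht. apply Ht. apply NoDup_app; [exact Hs|repeat constructor; auto|].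
  intros x Hx [->|[]]. contradiction.
Qed.

Lemma abs_summable_geom (r : R) : (0 <= r < 1)%R -> abs_summable (fun n => RtoC (r ^ n)).
Proof.
  intros Hr. exists (/ (1 - r))%R. intros l Hl.
  assert (Hb : exists N, incl l (seq 0 N)).
  { destruct (filterlim_seq (fun m => incl l m)) as [N HN]; [exists l; auto|].
    exists N. apply HN. lia. }
  destruct Hb as [N HN].
  assert (Hp : forall n, (0 <= r ^ n)%R) by (intros; apply pow_le; lra).
  apply Rle_trans with (Rsum_list (fun n => r ^ n)%R (seq 0 N)).
  - eapply Rle_trans; [apply (Rsum_list_le _ (fun n => r ^ n)%R)|apply Rsum_list_incl; auto].
    intros n. rewrite Cmod_R, Rabs_pos_eq; [lra|auto].
  - assert (E : (Rsum_list (fun n => r ^ n) (seq 0 N) * (1 - r) = 1 - r ^ N)%R).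
    { clear. induction N as [|N IH]; [unfold Rsum_list; simpl; ring|].
      rewrite seq_S, Rsum_list_app, Rmult_plus_distr_r, IH. unfold Rsum_list. simpl. ring. }
    apply Rmult_le_reg_r with (1 - r)%R; [lra|]. rewrite E, Rinv_l; [|lra].
    specialize (Hp N). lra.
Qed.

(** * Complex derivatives and the complex exponential *)

(** The form in which the derivatives of inversion and of exponential sums are established: a
    second-order remainder bound is easy to sum termwise. *)
Lemma is_derive_quadratic (f : C -> C) (z d : C) (K delta : R) :
  (0 < delta)%R ->
  (forall h : C, (Cmod h < delta)%R -> (Cmod (f (z + h)%C - f z - h * d)%C <= K * Cmod h ^ 2)%R) ->
  is_derive (K := C_AbsRing) (V := C_NormedModule) f z d.
Proof.
  intros Hd H. split; [apply (is_linear_scal_l (K := C_AbsRing) (V := C_NormedModule))|].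
  intros x Hx.
  (* [is_derive] quantifies over all limits x of the filter of neighbourhoods of z; there is only
     one. *)
  assert (x = z) as ->.
  { symmetry. apply (is_filter_lim_locally_unique (K := C_AbsRing)
      (V := AbsRing_NormedModule C_AbsRing) z x). exact Hx. }
  intros [e He]. simpl.
  assert (HK : (0 <= Rabs K)%R) by apply Rabs_pos.
  assert (Hm : (0 < Rmin delta (e / (Rabs K + 1)))%R)
    by (apply Rmin_pos; [|apply Rdiv_lt_0_compat]; lra).
  exists (mkposreal _ Hm). intros y Hy.
  change (Cmod (y - z) < Rmin delta (e / (Rabs K + 1)))%R in Hy.
  change (Cmod (f y - f z - (y - z) * d) <= e * Cmod (y - z))%R.
  set (h := y - z) in *. replace y with (z + h) by (unfold h; ring).
  pose proof (Rmin_l delta (e / (Rabs K + 1))).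
  pose proof (Rmin_r delta (e / (Rabs K + 1))).
  pose proof (Cmod_ge_0 h). pose proof (Rle_abs K).
  eapply Rle_trans; [apply H; lra|].
  replace (K * Cmod h ^ 2)%R with ((K * Cmod h) * Cmod h)%R by ring.
  apply Rmult_le_compat_r; [lra|].
  apply Rle_trans with ((Rabs K + 1) * Cmod h)%R; [nra|].
  apply Rle_trans with ((Rabs K + 1) * (e / (Rabs K + 1)))%R.
  - apply Rmult_le_compat_l; lra.
  - right. field. lra.
Qed.

(* [C_NormedModule] and [AbsRing_NormedModule C_AbsRing] have the same norm but different
   (equivalent) balls, so the two notions of derivative are not convertible. *)
Lemma is_derive_C_AbsRing (f : C -> C) (z d : C) :
  is_derive (K := C_AbsRing) (V := C_NormedModule) f z d <->
  is_derive (K := C_AbsRing) (V := AbsRing_NormedModule C_AbsRing) f z d.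
Proof.
  split; intros [[L1 L2 L3] H]; (split; [constructor; [exact L1|exact L2|exact L3]|exact H]).
Qed.

Lemma Cinv_near (z : C) (eps : R) : z <> 0 -> (0 < eps)%R ->
  exists d, (0 < d)%R /\ forall y, (Cmod (y - z) <= d)%R -> y <> 0 /\ (Cmod (/ y - / z) < eps)%R.
Proof.
  intros Hz Heps. apply Cmod_gt_0 in Hz as Hm. set (m := Cmod z) in *.
  (* The first bound gives |y| >= m / 2, so that |1/y - 1/z| <= 2 |y - z| / m^2, and the second
     makes this at most eps / 2. *)
  exists (Rmin (m / 2) (eps * m ^ 2 / 4)).
  assert (Hm2 : (0 < eps * m ^ 2)%R) by (apply Rmult_lt_0_compat; [|apply pow_lt]; lra).
  split; [apply Rmin_pos; lra|]. intros y Hy.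
  pose proof (Rmin_l (m / 2) (eps * m ^ 2 / 4)). pose proof (Rmin_r (m / 2) (eps * m ^ 2 / 4)).
  assert (Hym : (m / 2 <= Cmod y)%R).
  { assert (m <= Cmod y + Cmod (y - z))%R; [|lra].
    unfold m. replace z with (y + - (y - z)) at 1 by ring.
    eapply Rle_trans; [apply Cmod_triangle|]. rewrite Cmod_opp. lra. }
  assert (Hy0 : y <> 0) by (apply Cmod_gt_0; lra). split; [exact Hy0|].
  replace (/ y - / z) with (- (y - z) / (y * z)) by (field; auto).
  rewrite Cmod_div by (apply Cmult_neq_0; assumption). rewrite Cmod_opp, Cmod_mult. fold m.
  apply Rmult_lt_reg_r with (Cmod y * m)%R; [nra|].
  unfold Rdiv. rewrite Rmult_assoc, Rinv_l, Rmult_1_r by nra.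
  assert (eps * m * (m / 2) <= eps * m * Cmod y)%R by (apply Rmult_le_compat_l; nra).
  nra.
Qed.

Lemma is_derive_Cinv (z : C) : z <> 0 ->
  is_derive (K := C_AbsRing) (V := C_NormedModule) Cinv z (- / (z * z)).
Proof.
  intros Hz. destruct (Cinv_near z 1 Hz) as [d [Hd H]]; [lra|].
  apply Cmod_gt_0 in Hz as Hm.
  (* The remainder is exactly h^2 / (z^2 (z + h)), and 1 / (z + h) lies within 1 of 1 / z. *)
  apply (is_derive_quadratic _ _ _ (/ Cmod z ^ 2 * (1 + / Cmod z)) d Hd).
  intros h Hh. destruct (H (z + h)) as [Hzh Hlt].
  { replace (z + h - z) with h by ring. lra. }
  replace (/ (z + h) - / z - h * - / (z * z)) with (/ (z * z) * / (z + h) * (h * h))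
    by (field; auto).
  rewrite !Cmod_mult, Cmod_inv, Cmod_mult by (apply Cmult_neq_0; assumption).
  assert (Hb : (Cmod (/ (z + h)) <= 1 + / Cmod z)%R).
  { replace (/ (z + h)) with ((/ (z + h) - / z) + / z) by ring.
    eapply Rle_trans; [apply Cmod_triangle|]. rewrite (Cmod_inv z Hz). lra. }
  replace (Cmod h ^ 2)%R with (Cmod h * Cmod h)%R by ring.
  replace (Cmod z * Cmod z)%R with (Cmod z ^ 2)%R by ring.
  pose proof (Cmod_ge_0 h).
  apply Rmult_le_compat_r; [nra|]. apply Rmult_le_compat_l; [|exact Hb].
  apply Rlt_le, Rinv_0_lt_compat, pow_lt, Hm.
Qed.

Lemma Cexp_0 : Cexp 0 = 1.
Proof. unfold Cexp. simpl. rewrite exp_0, cos_0, sin_0. apply injective_projections; simpl; ring. Qed.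

Lemma Cexp_plus (z w : C) : Cexp (z + w) = Cexp z * Cexp w.
Proof.
  unfold Cexp, Cmult, Re, Im. simpl. rewrite exp_plus, cos_plus, sin_plus.
  apply injective_projections; simpl; ring.
Qed.

Lemma Cmod_Cexp (z : C) : Cmod (Cexp z) = exp (Re z).
Proof.
  unfold Cmod, Cexp. simpl fst. simpl snd.
  replace ((exp (Re z) * cos (Im z)) ^ 2 + (exp (Re z) * sin (Im z)) ^ 2)%R
    with (exp (Re z) ^ 2)%R.
  - apply sqrt_pow2, Rlt_le, exp_pos.
  - pose proof (sin2_cos2 (Im z)) as H. unfold Rsqr in H. nra.
Qed.

Lemma Cexp_neq0 (z : C) : Cexp z <> 0.
Proof. apply Cmod_gt_0. rewrite Cmod_Cexp. apply exp_pos. Qed.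

Lemma Cexp_opp (z : C) : Cexp (- z) = / Cexp z.
Proof.
  assert (H : Cexp (- z) * Cexp z = 1).
  { rewrite <- Cexp_plus. replace (- z + z) with (RtoC 0) by ring. apply Cexp_0. }
  transitivity (Cexp (- z) * Cexp z * / Cexp z); [field; apply Cexp_neq0|].
  rewrite H. ring.
Qed.

Lemma Cexp_pow (z : C) (n : nat) : Cexp (RtoC (INR n) * z) = Cexp z ^ n.
Proof.
  induction n as [|n IH].
  - simpl. rewrite Cmult_0_l. apply Cexp_0.
  - rewrite S_INR, RtoC_plus, Cmult_plus_distr_r, Cexp_plus, IH, Cpow_S, Cmult_1_l. ring.
Qed.

Lemma exp_le (x y : R) : (x <= y)%R -> (exp x <= exp y)%R.
Proof. intros [H|H]; [apply Rlt_le, exp_increasing, H|rewrite H; apply Rle_refl]. Qed.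

Lemma Rabs_exp_m1_le (x : R) : (Rabs (exp x - 1) <= Rabs x * exp (Rabs x))%R.
Proof.
  pose proof (exp_ineq1_le x). pose proof (exp_ineq1_le (- x)) as H1. pose proof (exp_pos x).
  assert (exp (- x) * exp x = 1)%R by (rewrite <- exp_plus; replace (- x + x)%R with 0%R by ring; apply exp_0).
  destruct (Rle_dec 0 x).
  - rewrite (Rabs_pos_eq x), Rabs_pos_eq; nra.
  - assert (exp x < 1)%R by (rewrite <- exp_0; apply exp_increasing; lra).
    rewrite (Rabs_left x), Rabs_left by lra.
    pose proof (exp_ineq1_le (- x)). nra.
Qed.

Lemma Rabs_exp_m1_mx_le (x : R) : (Rabs (exp x - 1 - x) <= x ^ 2 * exp (Rabs x))%R.
Proof.
  pose proof (exp_ineq1_le x). pose proof (exp_ineq1_le (- x)) as H1. pose proof (exp_pos x).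
  assert (exp (- x) * exp x = 1)%R by (rewrite <- exp_plus; replace (- x + x)%R with 0%R by ring; apply exp_0).
  rewrite Rabs_pos_eq by lra.
  (* Equivalent to exp x * (1 - x) <= 1, which is 1 - x <= exp (- x) multiplied by exp x. *)
  assert (H3 : (exp x - 1 - x <= x * (exp x - 1))%R) by nra.
  eapply Rle_trans; [exact H3|]. eapply Rle_trans; [apply Rle_abs|].
  rewrite Rabs_mult. replace (x ^ 2)%R with (Rabs x * Rabs x)%R by (rewrite <- Rabs_mult, Rabs_pos_eq; nra).
  rewrite Rmult_assoc. apply Rmult_le_compat_l; [apply Rabs_pos|apply Rabs_exp_m1_le].
Qed.

Lemma Rabs_sin_le (x : R) : (Rabs (sin x) <= Rabs x)%R.
Proof.
  destruct (MVT_gen sin 0 x cos) as [c [_ Hc]].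
  - intros. apply is_derive_Reals, derivable_pt_lim_sin.
  - intros. apply continuity_sin.
  - rewrite sin_0, !Rminus_0_r in Hc. rewrite Hc, Rabs_mult.
    assert (Rabs (cos c) <= 1)%R by (apply Rabs_le, COS_bound).
    pose proof (Rabs_pos x). nra.
Qed.

Lemma Rabs_cos_m1_le (x : R) : (Rabs (cos x - 1) <= x ^ 2 / 2)%R.
Proof.
  replace x with (2 * (x / 2))%R at 1 by field. rewrite cos_2a_sin.
  replace (1 - 2 * sin (x / 2) * sin (x / 2) - 1)%R with (- (2 * (sin (x / 2))²))%R by (unfold Rsqr; ring).
  rewrite Rabs_Ropp, Rabs_pos_eq; [|pose proof (Rle_0_sqr (sin (x / 2))); lra].
  assert ((sin (x / 2))² <= (x / 2)²)%R by (apply Rsqr_le_abs_1, Rabs_sin_le).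
  replace (x ^ 2 / 2)%R with (2 * (x / 2)²)%R by (unfold Rsqr; field). lra.
Qed.

Lemma Rabs_sin_mx_le (x : R) : (Rabs (sin x - x) <= x ^ 2)%R.
Proof.
  destruct (MVT_gen (fun y => sin y - y)%R 0 x (fun y => cos y - 1)%R) as [c [Hc1 Hc]].
  - intros. auto_derive; [trivial|ring].
  - intros y _. apply derivable_continuous_pt, ex_derive_Reals_0. auto_derive. trivial.
  - rewrite sin_0, !Rminus_0_r in Hc. rewrite Hc, Rabs_mult.
    assert (Hcx : (Rabs c <= Rabs x)%R).
    { revert Hc1. unfold Rmin, Rmax. destruct (Rle_dec 0 x); intros [H1 H2].
      - rewrite !Rabs_pos_eq; lra.
      - rewrite !Rabs_left1; lra. }
    (* For |c| <= 2 this follows from c^2 / 2 <= |c|, otherwise from |cos c - 1| <= 2. *)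
    assert (Hcos : (Rabs (cos c - 1) <= Rabs c)%R).
    { destruct (Rle_dec (Rabs c) 2) as [H|H].
      - eapply Rle_trans; [apply Rabs_cos_m1_le|].
        rewrite <- (pow2_abs c). pose proof (Rabs_pos c). nra.
      - apply Rle_trans with 2%R; [|lra]. apply Rabs_le. pose proof (COS_bound c). lra. }
    rewrite <- (pow2_abs x). pose proof (Rabs_pos x). nra.
Qed.

Lemma Im_le_Cmod (z : C) : (Rabs (Im z) <= Cmod z)%R.
Proof. eapply Rle_trans; [apply Rmax_r|apply Rmax_Cmod]. Qed.

Lemma Cmod_le_Rabs (z : C) : (Cmod z <= Rabs (Re z) + Rabs (Im z))%R.
Proof.
  replace z with (RtoC (Re z) + Ci * RtoC (Im z)) at 1
    by (destruct z; apply injective_projections; simpl; ring).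
  eapply Rle_trans; [apply Cmod_triangle|]. rewrite Cmod_mult, Cmod_Ci, !Cmod_R. lra.
Qed.

(** The real and the imaginary part each split into two products of one-variable remainders; each of
    the four pieces is at most |z|^2 exp |z|, whence the factor 4. *)
Lemma Cmod_Cexp_m1_mz_le (z : C) :
  (Cmod (Cexp z - 1 - z)%C <= 4 * Cmod z ^ 2 * exp (Cmod z))%R.
Proof.
  eapply Rle_trans; [apply Cmod_le_Rabs|].
  pose proof (re_le_Cmod z) as Hx. pose proof (Im_le_Cmod z) as Hy.
  destruct z as [x y]. set (m := Cmod (x, y)) in *. simpl in Hx, Hy.
  unfold Cexp. simpl.
  replace (exp x * cos y + - (1) + - x)%R with ((exp x - 1 - x) + exp x * (cos y - 1))%R by ring.
  replace (exp x * sin y + -0 + - y)%R with ((exp x - 1) * sin y + (sin y - y))%R by ring.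
  pose proof (Rabs_exp_m1_le x) as H1. pose proof (Rabs_exp_m1_mx_le x) as H2.
  pose proof (Rabs_cos_m1_le y) as H3. pose proof (Rabs_sin_mx_le y) as H4.
  pose proof (Rabs_sin_le y) as H5. rewrite <- (pow2_abs x) in H2.
  rewrite <- (pow2_abs y) in H3, H4.
  pose proof (Rabs_pos x). pose proof (Rabs_pos y).
  assert (He : (exp (Rabs x) <= exp m)%R) by (apply exp_le; lra).
  assert (He1 : (exp x <= exp m)%R) by (apply exp_le; pose proof (Rle_abs x); lra).
  assert (He2 : (1 <= exp m)%R) by (rewrite <- exp_0; apply exp_le; lra).
  set (E := exp m) in *. pose proof (exp_pos x). pose proof (exp_pos (Rabs x)).
  assert (Hxm : (Rabs x ^ 2 <= m ^ 2)%R) by (apply pow_incr; lra).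
  assert (Hym : (Rabs y ^ 2 <= m ^ 2)%R) by (apply pow_incr; lra).
  assert (A1 : (Rabs (exp x - 1 - x) <= m ^ 2 * E)%R).
  { eapply Rle_trans; [exact H2|]. apply Rmult_le_compat; nra. }
  assert (A2 : (Rabs (exp x * (cos y - 1)) <= m ^ 2 * E)%R).
  { rewrite Rabs_mult, (Rabs_pos_eq (exp x)), Rmult_comm by lra.
    apply Rmult_le_compat; try nra. apply Rabs_pos. }
  assert (A3 : (Rabs ((exp x - 1) * sin y) <= m ^ 2 * E)%R).
  { rewrite Rabs_mult. apply Rle_trans with ((m * E) * m)%R; [|right; ring].
    apply Rmult_le_compat; try apply Rabs_pos; [|lra].
    eapply Rle_trans; [exact H1|]. apply Rmult_le_compat; lra. }
  assert (A4 : (Rabs (sin y - y) <= m ^ 2 * E)%R).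
  { eapply Rle_trans; [exact H4|]. nra. }
  pose proof (Rabs_triang (exp x - 1 - x) (exp x * (cos y - 1))).
  pose proof (Rabs_triang ((exp x - 1) * sin y) (sin y - y)). lra.
Qed.

Lemma continuous_Cexp (z : C) : continuous (T := C_UniformSpace) (U := C_UniformSpace) Cexp z.
Proof.
  apply filterlim_Cmod; [apply locally_filter|]. intros eps Heps.
  (* A Lipschitz constant at z for increments with |h| <= 1, from |e^h - 1| <= 4 |h|^2 e^|h| +
     |h|. *)
  set (A := (exp (Re z) * (4 * exp 1 + 1))%R).
  assert (HA : (0 < A)%R) by (apply Rmult_lt_0_compat; pose proof (exp_pos 1); [apply exp_pos|lra]).
  apply locally_Cmod. exists (Rmin 1 (eps / A)). split; [apply Rmin_pos; [|apply Rdiv_lt_0_compat]; lra|].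
  intros y Hy. set (h := y - z) in *.
  pose proof (Rmin_l 1 (eps / A)). pose proof (Rmin_r 1 (eps / A)). pose proof (Cmod_ge_0 h).
  replace (Cexp y - Cexp z) with (Cexp z * ((Cexp h - 1 - h) + h)).
  2: { replace y with (z + h) by (unfold h; ring). rewrite Cexp_plus. ring. }
  rewrite Cmod_mult, Cmod_Cexp.
  apply Rle_lt_trans with (A * Cmod h)%R.
  - unfold A. rewrite Rmult_assoc. apply Rmult_le_compat_l; [apply Rlt_le, exp_pos|].
    eapply Rle_trans; [apply Cmod_triangle|].
    assert (exp (Cmod h) <= exp 1)%R by (apply exp_le; lra).
    pose proof (Cmod_Cexp_m1_mz_le h) as H3. pose proof (exp_pos (Cmod h)).
    assert (Cmod h ^ 2 * exp (Cmod h) <= Cmod h * exp 1)%R.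
    { apply Rmult_le_compat; nra. }
    lra.
  - apply Rlt_le_trans with (A * (eps / A))%R; [apply Rmult_lt_compat_l; lra|].
    right. field. lra.
Qed.

Lemma Cmod_Cexp_near (u v w : C) :
  (Cmod (Cexp (u * v)) <= Cmod (Cexp (u * w)) * exp (Cmod (v - w)%C * Cmod u))%R.
Proof.
  rewrite !Cmod_Cexp, <- exp_plus. apply exp_le.
  replace (u * v) with (u * w + (v - w) * u) by ring.
  change (Re (u * w) + Re ((v - w) * u) <= Re (u * w) + Cmod (v - w)%C * Cmod u)%R.
  rewrite <- Cmod_mult. pose proof (re_le_Cmod ((v - w) * u)). pose proof (Rle_abs (Re ((v - w) * u))).
  lra.
Qed.

Lemma Cmod_Cexp_lt1_near (u w : C) : (Cmod (Cexp (u * w)) < 1)%R ->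
  exists d, (0 < d)%R /\ forall v, (Cmod (v - w)%C <= d)%R -> (Cmod (Cexp (u * v)) < 1)%R.
Proof.
  intros H. rewrite Cmod_Cexp in H.
  assert (Hr : (Re (u * w) < 0)%R) by (apply exp_lt_inv; rewrite exp_0; exact H).
  pose proof (Cmod_ge_0 u) as Hu.
  exists (- Re (u * w) / (Cmod u + 1))%R. split; [apply Rdiv_lt_0_compat; lra|].
  intros v Hv. eapply Rle_lt_trans; [apply (Cmod_Cexp_near u v w)|].
  rewrite Cmod_Cexp, <- exp_plus, <- exp_0. apply exp_increasing.
  pose proof (Cmod_ge_0 (v - w)) as Hvw.
  assert (Cmod (v - w)%C * (Cmod u + 1) <= - Re (u * w))%R.
  { apply Rmult_le_reg_r with (/ (Cmod u + 1))%R; [apply Rinv_0_lt_compat; lra|].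
    rewrite Rmult_assoc, Rinv_r; lra. }
  (* The summand 1 in the denominator of the radius makes the inequality strict when v differs from
     w; at v = w strictness comes from [Hr]. *)
  destruct (Req_dec (Cmod (v - w)%C) 0) as [E|E]; [rewrite E|]; lra.
Qed.

(** * Generalized Dirichlet series *)

(* One of the four points [w + d], [w - d], [w + i d], [w - i d] increases [Re (s w)] by
   at least [|s| d / 2]; so absolute summability at these points controls a whole disc. *)
Lemma abs_summable_exp_majorant {I : Type} (c s : I -> C) (w : C) (d : R) :
  (0 < d)%R ->
  (forall v : C, (Cmod (v - w) <= d)%R -> abs_summable (fun i => c i * Cexp (s i * v))) ->
  abs_summable (fun i => RtoC (Cmod (c i) * exp (Re (s i * w)) * exp (d * Cmod (s i) / 2))).
Proof.
  intros Hd H.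
  assert (Hpt : forall u : C, Cmod u = 1%R -> abs_summable (fun i => c i * Cexp (s i * (w + RtoC d * u)))).
  { intros u Hu. apply H. replace (w + RtoC d * u - w) with (RtoC d * u) by ring.
    rewrite Cmod_mult, Hu, Cmod_R, Rabs_pos_eq; lra. }
  pose proof (Hpt 1 Cmod_1) as A1. pose proof (Hpt (- (1)) Cmod_m1) as A2.
  pose proof (Hpt Ci Cmod_Ci) as A3.
  assert (Cmod (- Ci) = 1%R) as HCi by (rewrite Cmod_opp; apply Cmod_Ci).
  pose proof (Hpt (- Ci) HCi) as A4. clear Hpt.
  pose proof (abs_summable_plus _ _ (abs_summable_plus _ _ A1 A2) (abs_summable_plus _ _ A3 A4)) as A.
  apply (abs_summable_le _ _ 1) with (2 := A). clear A A1 A2 A3 A4.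
  intros i. rewrite Rmult_1_l.
  rewrite !(Cmod_R), !Cmod_mult, !Cmod_Cexp.
  pose proof (Cmod_ge_0 (c i)) as Hc.
  assert (Hre : forall u : C, Re (s i * (w + RtoC d * u)) = (Re (s i * w) + d * Re (s i * u))%R).
  { intros u. replace (s i * (w + RtoC d * u)) with (s i * w + RtoC d * (s i * u)) by ring.
    simpl. ring. }
  rewrite !Hre, !exp_plus.
  assert (Hpos : forall x, (0 <= Cmod (c i) * (exp (Re (s i * w)) * exp x))%R).
  { intros x. apply Rmult_le_pos; [exact Hc|]. apply Rlt_le, Rmult_lt_0_compat; apply exp_pos. }
  (* Since |s| <= |Re s| + |Im s|, one of Re s, - Re s, Im s, - Im s is at least |s| / 2;
     multiplication by -i or i turns Im s or - Im s into a real part. *)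
  assert (Hmax : exists u : C, (u = 1 \/ u = - (1) \/ u = Ci \/ u = - Ci) /\ (Cmod (s i) / 2 <= Re (s i * u))%R).
  { pose proof (Cmod_le_Rabs (s i)) as Hm. destruct (s i) as [x y]. simpl in Hm.
    unfold Rabs in Hm.
    destruct (Rle_dec (Cmod (x, y) / 2) x); [exists 1; split; [tauto|simpl; lra]|].
    destruct (Rle_dec (Cmod (x, y) / 2) (- x)); [exists (- (1)); split; [tauto|simpl; lra]|].
    destruct (Rle_dec (Cmod (x, y) / 2) y); [exists (- Ci); split; [tauto|simpl; lra]|].
    destruct (Rle_dec (Cmod (x, y) / 2) (- y)); [exists Ci; split; [tauto|simpl; lra]|].
    exfalso. destruct (Rcase_abs x), (Rcase_abs y); lra. }
  destruct Hmax as [u [Hu Hmax]].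
  assert (Hle : (Cmod (c i) * (exp (Re (s i * w)) * exp (d * Cmod (s i) / 2)) <=
    Cmod (c i) * (exp (Re (s i * w)) * exp (d * Re (s i * u))))%R).
  { apply Rmult_le_compat_l; [exact Hc|]. apply Rmult_le_compat_l; [apply Rlt_le, exp_pos|].
    apply exp_le. nra. }
  rewrite (Rmult_assoc (Cmod (c i))).
  pose proof (Hpos (d * Re (s i * 1))%R). pose proof (Hpos (d * Re (s i * - (1)))%R).
  pose proof (Hpos (d * Re (s i * Ci))%R). pose proof (Hpos (d * Re (s i * - Ci))%R).
  rewrite (Rabs_pos_eq (_ * (_ * exp (d * Cmod (s i) / 2))))
    by (apply Rmult_le_pos; [exact Hc|]; apply Rlt_le, Rmult_lt_0_compat; apply exp_pos).
  rewrite !(Rabs_pos_eq) by (repeat rewrite Rabs_pos_eq by lra; lra).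
  destruct Hu as [-> | [-> | [-> | ->]]]; lra.
Qed.

Lemma le_exp (x : R) : (x <= exp x)%R.
Proof. pose proof (exp_ineq1_le x). lra. Qed.

Lemma sqr_le_exp (x : R) : (0 <= x)%R -> (x ^ 2 <= 4 * exp x)%R.
Proof.
  intros Hx. replace x with (x / 2 + x / 2)%R at 2 by field. rewrite exp_plus.
  pose proof (le_exp (x / 2)). nra.
Qed.

(** The remainder at h is the sum of c e^(s w) (e^(s h) - 1 - s h), with the last factor at most 4
    |s h|^2 e^|s h|. For |h| < d / 4 the spare factor e^(d |s| / 2) pays twice: one half for e^|s
    h|, the other for |s|^2 through x^2 <= 4 e^x at x = d |s| / 4. This gives 4 * 16 * 4 / d^2 = 256
    / d^2. *)
Lemma is_usum_derive {I : Type} (c s : I -> C) (f : C -> C) (w : C) (d : R) :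
  (0 < d)%R ->
  (forall v : C, (Cmod (v - w) <= d)%R -> abs_summable (fun i => c i * Cexp (s i * v))) ->
  (forall v : C, (Cmod (v - w) <= d)%R -> is_usum (fun i => c i * Cexp (s i * v)) (f v)) ->
  abs_summable (fun i => c i * s i * Cexp (s i * w)) /\
  forall D : C, is_usum (fun i => c i * s i * Cexp (s i * w)) D ->
  is_derive (K := C_AbsRing) (V := C_NormedModule) f w D.
Proof.
  intros Hd Hs Hf. pose proof (abs_summable_exp_majorant c s w d Hd Hs) as HM.
  assert (Hbd : forall i, (0 <= Cmod (s i) * d)%R)
    by (intros i; apply Rmult_le_pos; [apply Cmod_ge_0|lra]).
  split.
  - apply (abs_summable_le _ _ (2 / d)) with (2 := HM). intros i.
    rewrite !Cmod_mult, Cmod_R, Cmod_Cexp.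
    pose proof (Cmod_ge_0 (c i)) as Hc. pose proof (Cmod_ge_0 (s i)) as Hsi.
    pose proof (exp_pos (Re (s i * w))) as He.
    rewrite Rabs_pos_eq
      by (apply Rmult_le_pos; [apply Rmult_le_pos; lra|apply Rlt_le, exp_pos]).
    replace (Cmod (c i) * Cmod (s i) * exp (Re (s i * w)))%R
      with (2 / d * (Cmod (c i) * exp (Re (s i * w)) * (d * Cmod (s i) / 2)))%R by (field; lra).
    apply Rmult_le_compat_l; [apply Rlt_le, Rdiv_lt_0_compat; lra|].
    apply Rmult_le_compat_l; [apply Rmult_le_pos; lra|apply le_exp].
  - intros D HD. destruct HM as [M HM].
    apply (is_derive_quadratic _ _ _ (256 / d ^ 2 * M) (d / 4)); [lra|].
    intros h Hh. pose proof (Cmod_ge_0 h) as Hh0.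
    assert (HS : is_usum (fun i => c i * Cexp (s i * w) * (Cexp (s i * h) - 1 - s i * h))
      (f (w + h) - f w - h * D)).
    { pose proof (Hf (w + h)) as H1. specialize (H1 ltac:(replace (w + h - w) with h by ring; lra)).
      pose proof (Hf w) as H2.
      specialize (H2 ltac:(replace (w - w) with (RtoC 0) by ring; rewrite Cmod_0; lra)).
      pose proof (is_usum_plus _ _ _ _ (is_usum_plus _ _ _ _ H1 (is_usum_scal _ (- (1)) _ H2))
        (is_usum_scal _ (- h) _ HD)) as H3.
      replace (f (w + h) - f w - h * D) with (f (w + h) + - (1) * f w + - h * D) by ring.
      apply is_usum_ext with (2 := H3). intros i.
      rewrite Cmult_plus_distr_l, Cexp_plus. ring. }
    apply (is_usum_Cmod_le _ _ _ HS). intros l Hl. specialize (HM l Hl).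
    apply Rle_trans with (Rsum_list (fun i => (256 / d ^ 2 * Cmod h ^ 2) *
      Cmod (RtoC (Cmod (c i) * exp (Re (s i * w)) * exp (d * Cmod (s i) / 2))))%R l).
    + apply Rsum_list_le. intros i.
      rewrite !Cmod_mult, Cmod_R, Cmod_Cexp.
      pose proof (Cmod_ge_0 (c i)) as Hc. pose proof (Cmod_ge_0 (s i)) as Hsi.
      pose proof (exp_pos (Re (s i * w))) as He.
      rewrite Rabs_pos_eq
        by (apply Rmult_le_pos; [apply Rmult_le_pos; lra|apply Rlt_le, exp_pos]).
      replace (256 / d ^ 2 * Cmod h ^ 2 * (Cmod (c i) * exp (Re (s i * w)) * exp (d * Cmod (s i) / 2)))%R
        with (Cmod (c i) * exp (Re (s i * w)) * (256 / d ^ 2 * Cmod h ^ 2 * exp (d * Cmod (s i) / 2)))%R by ring.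
      apply Rmult_le_compat_l; [apply Rmult_le_pos; lra|].
      eapply Rle_trans; [apply Cmod_Cexp_m1_mz_le|]. rewrite Cmod_mult.
      replace (d * Cmod (s i) / 2)%R with (d * Cmod (s i) / 4 + d * Cmod (s i) / 4)%R by field.
      rewrite exp_plus.
      assert (E1 : (exp (Cmod (s i) * Cmod h) <= exp (d * Cmod (s i) / 4))%R)
        by (apply exp_le; nra).
      assert (E2 : ((d * Cmod (s i) / 4) ^ 2 <= 4 * exp (d * Cmod (s i) / 4))%R)
        by (apply sqr_le_exp; specialize (Hbd i); lra).
      replace (4 * (Cmod (s i) * Cmod h) ^ 2 * exp (Cmod (s i) * Cmod h))%R with
        (64 / d ^ 2 * Cmod h ^ 2 * ((d * Cmod (s i) / 4) ^ 2 * exp (Cmod (s i) * Cmod h)))%R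
        by (field; lra).
      set (X := exp (d * Cmod (s i) / 4)) in *.
      apply Rle_trans with (64 / d ^ 2 * Cmod h ^ 2 * (4 * X * X))%R; [|right; field; lra].
      apply Rmult_le_compat_l.
      * apply Rmult_le_pos; [apply Rlt_le, Rdiv_lt_0_compat; [lra|apply pow_lt; lra]|apply pow_le; lra].
      * apply Rmult_le_compat; [apply pow2_ge_0|apply Rlt_le, exp_pos|lra|lra].
    + rewrite Rsum_list_scal.
      replace (256 / d ^ 2 * M * Cmod h ^ 2)%R with (256 / d ^ 2 * Cmod h ^ 2 * M)%R by ring.
      apply Rmult_le_compat_l; [|exact HM].
      apply Rmult_le_pos; [apply Rlt_le, Rdiv_lt_0_compat; [lra|apply pow_lt; lra]|apply pow_le; lra].
Qed.

(** * The principal logarithm *)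

(** On the right half-plane, which contains 1 - x for |x| < 1, this replaces a case distinction and
    an arccosine that is singular on the real axis by a smooth expression. *)
Lemma Carg_atan (z : C) : (0 < Re z)%R -> Carg z = atan (Im z / Re z).
Proof.
  intros Hx. unfold Carg. destruct z as [x y]. simpl in *.
  assert (Hm : (0 < Cmod (x, y))%R) by (apply Cmod_gt_0; intros E; injection E; lra).
  assert (Hc : (x / Cmod (x, y) = cos (atan (y / x)))%R).
  { rewrite cos_atan. replace (1 + (y / x)²)%R with ((x ^ 2 + y ^ 2) / x²)%R by (unfold Rsqr; field; lra).
    rewrite sqrt_div_alt by (apply Rlt_0_sqr; lra). rewrite sqrt_Rsqr by lra.
    change (sqrt (x ^ 2 + y ^ 2)) with (Cmod (x, y)). field. lra. }
  rewrite Hc. pose proof (atan_bound (y / x)) as Hb. pose proof PI_RGT_0.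
  destruct (Rle_dec 0 y) as [Hy|Hy].
  - apply acos_cos. split; [|lra].
    rewrite <- atan_0. destruct Hy as [Hy|<-].
    + apply Rlt_le, atan_increasing. apply Rdiv_lt_0_compat; lra.
    + unfold Rdiv. rewrite Rmult_0_l. lra.
  - rewrite <- cos_neg, acos_cos; [ring|].
    assert (atan (y / x) < 0)%R; [|lra].
    rewrite <- atan_0. apply atan_increasing. unfold Rdiv.
    apply Rmult_lt_reg_r with x; [lra|]. rewrite Rmult_assoc, Rinv_l by lra. lra.
Qed.

Lemma is_usum_geom (x : C) : (Cmod x < 1)%R ->
  abs_summable (fun n => x ^ n) /\ is_usum (fun n => x ^ n) (1 / (1 - x)).
Proof.
  intros Hx. pose proof (Cmod_ge_0 x) as H0.
  assert (Ha : abs_summable (fun n => x ^ n)).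
  { apply (abs_summable_le _ (fun n => RtoC (Cmod x ^ n)) 1).
    - intros n. rewrite Cmod_pow, Cmod_R, Rabs_pos_eq; [lra|apply pow_le, H0].
    - apply abs_summable_geom. lra. }
  split; [exact Ha|]. destruct (abs_summable_usum _ Ha) as [S HS].
  replace (1 / (1 - x)) with S; [exact HS|].
  pose proof (is_usum_series _ _ HS) as H1.
  pose proof (is_usum_series _ _ (is_usum_scal _ x _ HS)) as H2.
  assert (H3 : is_series (V := C_NormedModule) (fun n => x ^ Datatypes.S n) (S - 1)).
  { apply (is_series_incr_1 (V := C_NormedModule) (fun n => x ^ n)).
    match goal with |- is_series _ ?l => replace l with S; [exact H1|] end.
    change (S = S - 1 + 1). ring. }
  (* Multiplying by x and dropping the first term produce the same series. *)
  assert (E : x * S = S - 1).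
  { apply (filterlim_locally_unique (V := C_NormedModule) (F := eventually) (sum_n (fun n => x * x ^ n)));
      [exact H2|exact H3]. }
  assert (H4 : 1 - x <> 0).
  { intros E1. assert (x = 1) as -> by (rewrite <- (Cplus_0_r x), <- E1; ring).
    rewrite Cmod_1 in Hx. lra. }
  transitivity ((S - x * S) / (1 - x)); [field; exact H4|].
  rewrite E. field. exact H4.
Qed.

(** Used with h equal to [Re] and [Im], so that both parts of the logarithm reduce to real power
    series by one argument. *)
Lemma is_usum_series_R (h : C -> R) (f : nat -> C) (S : C) :
  (forall x y, h (x + y) = (h x + h y)%R) -> (forall x, (Rabs (h x) <= Cmod x)%R) ->
  is_usum f S -> is_series (fun n => h (f n)) (h S).
Proof.
  intros hD hle Hf. apply is_usum_series in Hf.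
  apply filterlim_locally. intros [e He].
  generalize (proj1 (filterlim_Cmod eventually (sum_n f) S) Hf e He). apply filter_imp.
  intros n Hn. change (Rabs (sum_n (fun k => h (f k)) n - h S) < e)%R.
  replace (sum_n (fun k => h (f k)) n - h S)%R with (h (sum_n f n - S)).
  - eapply Rle_lt_trans; [apply hle|exact Hn].
  - assert (h0 : h 0 = 0%R) by (pose proof (hD 0 0) as E; rewrite Cplus_0_l in E; lra).
    assert (hN : h (- S) = (- h S)%R)
      by (pose proof (hD S (- S)) as E; rewrite Cplus_opp_r in E; lra).
    unfold Cminus. rewrite hD, hN. unfold Rminus. f_equal.
    clear Hn. induction n as [|n IH]; [now rewrite !sum_O|].
    rewrite !sum_Sn. change (@plus (NormedModule.AbelianMonoid C_AbsRing C_NormedModule)) with Cplus.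
    rewrite hD, IH. reflexivity.
Qed.

Lemma abs_summable_log_series (x : C) : (Cmod x < 1)%R ->
  abs_summable (fun n => x ^ S n / RtoC (INR (S n))).
Proof.
  intros Hx. apply (abs_summable_le _ _ 1) with (2 := proj1 (is_usum_geom x Hx)).
  intros n. assert (Hn : (1 <= INR (S n))%R) by (rewrite S_INR; pose proof (pos_INR n); lra).
  rewrite Cmod_div by (intros E; apply RtoC_inj in E; lra).
  rewrite Cpow_S, Cmod_mult, Cmod_R, Rabs_pos_eq by lra.
  pose proof (Cmod_ge_0 x). pose proof (Cmod_ge_0 (x ^ n)).
  apply Rmult_le_reg_r with (INR (S n)); [lra|]. unfold Rdiv.
  rewrite Rmult_assoc, Rinv_l by lra. nra.
Qed.

Lemma log_series_derive (h : C -> R) (x : C) (s : R) :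
  (forall x y, h (x + y) = (h x + h y)%R) -> (forall x, (Rabs (h x) <= Cmod x)%R) ->
  (forall (r : R) z, h (RtoC r * z) = (r * h z)%R) ->
  (Cmod x < 1)%R -> (0 <= s <= 1)%R ->
  is_derive (PSeries (fun n => h (x ^ n)%C / INR n)%R) s (h (x / (1 - RtoC s * x))%C).
Proof.
  intros hD hle hZ Hx Hs. set (a := fun n => (h (x ^ n)%C / INR n)%R).
  pose proof (Cmod_ge_0 x) as Hx0.
  assert (HR : Rbar_lt 1 (CV_radius a)).
  { destruct (CV_radius_bounded a) as [Hub _].
    (* A radius with 1 < r and |x| r <= 1: the coefficients times r^n stay bounded, so termwise
       differentiation is valid up to and including s = 1. *)
    set (r := (2 / (1 + Cmod x))%R).
    assert (Hr : (1 < r)%R).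
    { unfold r. apply Rmult_lt_reg_r with (1 + Cmod x)%R; [lra|].
      unfold Rdiv. rewrite Rmult_assoc, Rinv_l; lra. }
    assert (Hxr : (Cmod x * r <= 1)%R).
    { unfold r. apply Rmult_le_reg_r with (1 + Cmod x)%R; [lra|].
      replace (Cmod x * (2 / (1 + Cmod x)) * (1 + Cmod x))%R with (2 * Cmod x)%R by (field; lra). lra. }
    apply Rbar_lt_le_trans with r; [exact Hr|]. apply Hub.
    exists (Rmax 1 (Rabs (a 0%nat))). intros n. destruct n as [|n].
    - rewrite Rmult_1_r. apply Rmax_r.
    - apply Rle_trans with 1%R; [|apply Rmax_l]. unfold a.
      assert (Hn : (1 <= INR (S n))%R) by (rewrite S_INR; pose proof (pos_INR n); lra).
      set (N := INR (S n)) in *. set (m := S n).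
      unfold Rdiv. rewrite !Rabs_mult, Rabs_inv, (Rabs_pos_eq N), (Rabs_pos_eq (r ^ m))
        by (try apply pow_le; lra).
      assert (H1 : (Rabs (h (x ^ m)%C) * r ^ m <= 1)%R).
      { apply Rle_trans with (Cmod x ^ m * r ^ m)%R.
        - apply Rmult_le_compat_r; [apply pow_le; lra|]. rewrite <- Cmod_pow. apply hle.
        - rewrite <- Rpow_mult_distr. rewrite <- (pow1 m). apply pow_incr.
          split; [apply Rmult_le_pos; lra|lra]. }
      apply Rmult_le_reg_r with N; [lra|].
      replace (Rabs (h (x ^ m)%C) * / N * r ^ m * N)%R with (Rabs (h (x ^ m)%C) * r ^ m)%R by (field; lra).
      lra. }
  assert (Hd : is_derive (PSeries a) s (PSeries (PS_derive a) s)).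
  { apply is_derive_PSeries. apply Rbar_le_lt_trans with 1%R; [|exact HR].
    simpl. rewrite Rabs_pos_eq; lra. }
  replace (h (x / (1 - RtoC s * x))%C) with (PSeries (PS_derive a) s); [exact Hd|].
  apply is_series_unique.
  assert (Hsx : (Cmod (RtoC s * x) < 1)%R).
  { rewrite Cmod_mult, Cmod_R, Rabs_pos_eq by lra. nra. }
  pose proof (is_usum_scal _ x _ (proj2 (is_usum_geom _ Hsx))) as HU.
  apply (is_usum_series_R h) in HU; [|exact hD|exact hle].
  replace (x / (1 - RtoC s * x)) with (x * (1 / (1 - RtoC s * x))) by (unfold Cdiv; ring).
  apply is_series_ext with (2 := HU). intros n. unfold PS_derive, a.
  rewrite Cpow_mult_l, <- RtoC_pow.
  replace (x * (RtoC (s ^ n) * x ^ n)) with (RtoC (s ^ n) * x ^ S n) by (rewrite Cpow_S; ring).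
  rewrite hZ. match goal with |- ?u = ?v => change (@eq R u v) end. field. apply not_0_INR. lia.
Qed.

(** Along the segment from 0 to x, the power series in s and - g have the same derivative and the
    same value at s = 0; the claim is their equality at s = 1. *)
Lemma log_series_R (h : C -> R) (g : R -> R) (x : C) :
  (forall x y, h (x + y) = (h x + h y)%R) -> (forall x, (Rabs (h x) <= Cmod x)%R) ->
  (forall (r : R) z, h (RtoC r * z) = (r * h z)%R) ->
  (Cmod x < 1)%R -> g 0%R = 0%R ->
  (forall s, (0 <= s <= 1)%R -> is_derive g s (- h (x / (1 - RtoC s * x))%C)%R) ->
  forall S, is_usum (fun n => x ^ Datatypes.S n / RtoC (INR (Datatypes.S n))) S -> h S = (- g 1)%R.
Proof.
  intros hD hle hZ Hx g0 Hg S HS.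
  set (a := fun n => (h (x ^ n)%C / INR n)%R).
  (* The inverse of 0 is 0 here, so the coefficient of index 0 vanishes and the series effectively
     starts at 1. *)
  assert (a0 : a 0%nat = 0%R) by (unfold a; simpl; unfold Rdiv; rewrite Rinv_0; ring).
  assert (E1 : PSeries a 1 = h S).
  { unfold PSeries. rewrite Series_incr_1_aux by (rewrite a0; ring).
    apply is_series_unique. apply (is_usum_series_R h) in HS; [|exact hD|exact hle].
    apply is_series_ext with (2 := HS). intros n. rewrite pow1, Rmult_1_r. unfold a.
    assert (INR (Datatypes.S n) <> 0%R) by (apply not_0_INR; lia).
    unfold Cdiv. rewrite <- RtoC_inv by assumption. rewrite Cmult_comm, hZ. match goal with |- ?u = ?v => change (@eq R u v) end. field. assumption. }
  assert (E : (PSeries a 0 + g 0 = PSeries a 1 + g 1)%R).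
  { apply (eq_is_derive (V := R_NormedModule) (fun s => PSeries a s + g s)%R 0 1); [|lra].
    intros s Hs. pose proof (log_series_derive h x s hD hle hZ Hx Hs) as H1.
    pose proof (is_derive_plus _ _ _ _ _ H1 (Hg s Hs)) as H2.
    change zero with 0%R. replace 0%R with (h (x / (1 - RtoC s * x))%C + - h (x / (1 - RtoC s * x))%C)%R by ring.
    exact H2. }
  rewrite PSeries_0, a0, g0, E1 in E. lra.
Qed.

Lemma Re_1_minus_gt0 (x : C) (s : R) : (Cmod x < 1)%R -> (0 <= s <= 1)%R -> (0 < 1 - s * Re x)%R.
Proof.
  intros Hx Hs. pose proof (re_le_Cmod x). pose proof (Rle_abs (Re x)).
  destruct (Rle_dec (Re x) 0); nra.
Qed.

(** Integrates the derivative - x / (1 - s x) of log (1 - s x) over s in [0, 1]. As Re (1 - s x) > 0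
    throughout, the path avoids the cut and the value at s = 1 is the principal one. *)
Lemma is_usum_log (x : C) : (Cmod x < 1)%R ->
  is_usum (fun n => x ^ S n / RtoC (INR (S n))) (- Clog (1 - x)).
Proof.
  intros Hx. destruct (abs_summable_usum _ (abs_summable_log_series x Hx)) as [S HS].
  replace (- Clog (1 - x)) with S; [exact HS|].
  pose proof (Re_1_minus_gt0 x) as Hpos. destruct x as [p q]. simpl Re in Hpos.
  assert (Hdiv : forall s, (0 <= s <= 1)%R -> (p, q) / (1 - RtoC s * (p, q)) =
    ((p - s * (p ^ 2 + q ^ 2)) / ((1 - s * p) ^ 2 + (s * q) ^ 2),
      q / ((1 - s * p) ^ 2 + (s * q) ^ 2))%R).
  { intros s Hs. specialize (Hpos s Hx Hs).
    assert (((1 - s * p) ^ 2 + (s * q) ^ 2) <> 0)%R by nra.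
    unfold Cdiv, Cinv, Cmult. simpl.
    apply injective_projections; simpl; field; nra. }
  apply injective_projections.
  - replace (fst (- Clog (1 - (p, q)))) with (- ln (sqrt ((1 - 1 * p) ^ 2 + (1 * q) ^ 2)))%R.
    + apply (log_series_R Re (fun s => ln (sqrt ((1 - s * p) ^ 2 + (s * q) ^ 2)))%R (p, q));
        [reflexivity|apply re_le_Cmod|apply re_scal_l|exact Hx| | |exact HS].
      * replace ((1 - 0 * p) ^ 2 + (0 * q) ^ 2)%R with 1%R by ring.
        now rewrite sqrt_1, ln_1.
      * intros s Hs. rewrite Hdiv by exact Hs. specialize (Hpos s Hx Hs). simpl Re.
        assert (HN : (0 < (1 - s * p) ^ 2 + (s * q) ^ 2)%R) by nra.
        pose proof (sqrt_lt_R0 _ HN) as Hsq.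
        auto_derive; [repeat split; try assumption|].
        replace (s * q * (s * q * 1))%R with ((s * q) ^ 2)%R by ring.
        replace ((1 + - (s * p)) * ((1 + - (s * p)) * 1))%R with ((1 - s * p) ^ 2)%R by ring.
        pose proof (sqrt_sqrt _ (Rlt_le _ _ HN)) as Hss.
        set (N := ((1 - s * p) ^ 2 + (s * q) ^ 2)%R) in *.
        transitivity (- (p - s * (p ^ 2 + q ^ 2)) / (sqrt N * sqrt N))%R; [field; lra|].
        rewrite Hss. unfold N in *. field. nra.
    + simpl. f_equal. f_equal. unfold Cmod. simpl. f_equal. ring.
  - replace (snd (- Clog (1 - (p, q)))) with (- atan (- (1 * q) / (1 - 1 * p)))%R.
    + apply (log_series_R Im (fun s => atan (- (s * q) / (1 - s * p)))%R (p, q));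
        [reflexivity|apply Im_le_Cmod|apply im_scal_l|exact Hx| | |exact HS].
      * replace (- (0 * q) / (1 - 0 * p))%R with 0%R by field. apply atan_0.
      * intros s Hs. rewrite Hdiv by exact Hs. specialize (Hpos s Hx Hs). simpl Im.
        auto_derive; [lra|]. unfold Rsqr. field. repeat split; nra.
    + specialize (Hpos 1%R Hx ltac:(lra)).
      change (snd (- Clog (1 - (p, q)))) with (- Carg (1 - (p, q)))%R.
      rewrite Carg_atan by (simpl; lra). f_equal. f_equal. simpl. f_equal; ring.
Qed.

(** * The double expansion of the prepotential *)

(* With [w = 1 / lambda] one has [Q'^b = e^(a t_b w)] and [q' = e^(a w)] for [a = 4 pi^2 i]. *)
Definition dual_freq : C := RtoC (4 * PI * PI) * Ci.

Lemma RtoC_PI_neq0 : RtoC PI <> 0.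
Proof. intros E. apply RtoC_inj in E. pose proof PI_RGT_0. lra. Qed.

Lemma Q'_Cexp {B : Type} (l : C) (t : B -> C) (b : B) : l <> 0 ->
  Q' l t b = Cexp (dual_freq * t b * / l).
Proof.
  intros Hl. unfold Q', Ce, lambda_check, dual_freq. f_equal.
  rewrite !RtoC_mult. field. repeat split; (exact Hl || exact RtoC_PI_neq0).
Qed.

Lemma q'_Cexp (l : C) : l <> 0 -> q' l = Cexp (dual_freq * / l).
Proof.
  intros Hl. unfold q', Ce, lambda_check, dual_freq. f_equal.
  rewrite !RtoC_mult. field. repeat split; (exact Hl || exact RtoC_PI_neq0).
Qed.

Section Expansion.
Context {B : Type} (GV : B -> Z) (t : B -> C).

(* Expanding [1 / (1 - q'^k)] and [Li_2] turns the prepotential into the sum over [(b, (m, n))]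
   of [GV_b / k^2 * (Q'^b q'^m)^k] with [k = n + 1], an exponential sum in [w]. *)
Definition prepot_coef (i : B * (nat * nat)) : C :=
  RtoC (IZR (GV (fst i))) / RtoC (INR (S (snd (snd i)))) ^ 2.

Definition prepot_freq (i : B * (nat * nat)) : C :=
  dual_freq * RtoC (INR (S (snd (snd i)))) * (t (fst i) + RtoC (INR (fst (snd i)))).

Definition prepot_term (w : C) (i : B * (nat * nat)) : C :=
  prepot_coef i * Cexp (prepot_freq i * w).

(** The bound on |Q'^b| is restricted to GV_b <> 0 because only there does summability control it
    uniformly in b; the other classes contribute zero terms. *)
Definition convergent_at (w : C) : Prop :=
  (Cmod (Cexp (dual_freq * w)) < 1)%R /\
  (forall b, GV b <> 0%Z -> (Cmod (Cexp (dual_freq * t b * w)) < 1)%R) /\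
  abs_summable (fun b => RtoC (IZR (GV b)) * Cexp (dual_freq * t b * w)).

Lemma Cexp_prepot_freq (w : C) (b : B) (m n : nat) :
  Cexp (prepot_freq (b, (m, n)) * w) =
  (Cexp (dual_freq * t b * w) * Cexp (dual_freq * w) ^ m) ^ S n.
Proof.
  rewrite <- Cexp_pow, <- Cexp_plus, <- Cexp_pow. f_equal. unfold prepot_freq. simpl fst. simpl snd. ring.
Qed.

Lemma RtoC_INR_S_neq0 (n : nat) : RtoC (INR (S n)) <> 0.
Proof. intros E. apply RtoC_inj in E. apply not_0_INR in E; [exact E|lia]. Qed.

(** A single r < 1 bounds |q'| and all |Q'^b| with GV_b <> 0: since |GV_b| >= 1 for these, only
    finitely many |Q'^b| exceed 1 / 2. Splitting one factor off (Q'^b q'^m)^(n+1) then gives the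
    majorant |GV_b Q'^b| r^m r^n. *)
Lemma abs_summable_prepot (w : C) : convergent_at w -> abs_summable (prepot_term w).
Proof.
  intros [Hq [HQ Hs]].
  assert (Hr : exists r, (0 <= r < 1)%R /\ (Cmod (Cexp (dual_freq * w)) <= r)%R /\
    forall b, GV b <> 0%Z -> (Cmod (Cexp (dual_freq * t b * w)) <= r)%R).
  { destruct (abs_summable_small _ (1 / 2) Hs) as [s Hsmall]; [lra|].
    assert (Hfin : exists r, (r < 1)%R /\ forall b, In b s -> GV b <> 0%Z ->
      (Cmod (Cexp (dual_freq * t b * w)) <= r)%R).
    { clear Hsmall. induction s as [|b s [r [Hr1 Hr2]]]; [exists 0%R; split; [lra|intros b []]|].
      destruct (Z.eq_dec (GV b) 0) as [E|E].
      - exists r. split; [exact Hr1|]. intros b' [->|Hb]; [contradiction|auto].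
      - exists (Rmax r (Cmod (Cexp (dual_freq * t b * w)))).
        split; [apply Rmax_lub_lt; auto|].
        intros b' [->|Hb] Hb'; [apply Rmax_r|].
        eapply Rle_trans; [apply Hr2; assumption|apply Rmax_l]. }
    destruct Hfin as [r [Hr1 Hr2]].
    exists (Rmax (Rmax (1 / 2) r) (Cmod (Cexp (dual_freq * w)))).
    pose proof (Rmax_l (Rmax (1 / 2) r) (Cmod (Cexp (dual_freq * w)))).
    pose proof (Rmax_r (Rmax (1 / 2) r) (Cmod (Cexp (dual_freq * w)))).
    pose proof (Rmax_l (1 / 2) r). pose proof (Rmax_r (1 / 2) r).
    split; [split; [lra|apply Rmax_lub_lt; [apply Rmax_lub_lt; lra|exact Hq]]|].
    split; [lra|]. intros b Hb. destruct (classic (In b s)) as [Hin|Hin].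
    - specialize (Hr2 b Hin Hb). lra.
    - specialize (Hsmall b Hin). rewrite Cmod_mult, Cmod_R in Hsmall.
      assert (1 <= Rabs (IZR (GV b)))%R by (rewrite <- abs_IZR; apply IZR_le; lia).
      pose proof (Cmod_ge_0 (Cexp (dual_freq * t b * w))). nra. }
  destruct Hr as [r [Hr [Hqr HQr]]].
  apply (abs_summable_le _ (fun i => (RtoC (IZR (GV (fst i))) * Cexp (dual_freq * t (fst i) * w)) *
    (RtoC (r ^ fst (snd i)) * RtoC (r ^ snd (snd i)))) 1).
  2: { apply (abs_summable_prod _ (fun p : nat * nat => RtoC (r ^ fst p) * RtoC (r ^ snd p)) Hs).
       apply (abs_summable_prod (fun n => RtoC (r ^ n)) (fun n => RtoC (r ^ n)));
         apply abs_summable_geom, Hr. }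
  intros [b [m n]]. unfold prepot_term. rewrite Cexp_prepot_freq. unfold prepot_coef. simpl fst. simpl snd.
  destruct (Z.eq_dec (GV b) 0) as [E|E].
  { rewrite E. unfold Cdiv. rewrite !Cmult_0_l, Cmod_0. lra. }
  specialize (HQr b E).
  set (Q := Cexp (dual_freq * t b * w)) in *. set (q := Cexp (dual_freq * w)) in *.
  rewrite Rmult_1_l, (Cpow_S (Q * q ^ m)).
  rewrite Cmod_mult, Cmod_div by (apply Cpow_nz, RtoC_INR_S_neq0).
  rewrite !Cmod_mult, !Cmod_pow, Cmod_mult, Cmod_pow, !Cmod_R.
  assert (Hp : forall k, (0 <= r ^ k)%R) by (intros; apply pow_le; lra).
  rewrite (Rabs_pos_eq (r ^ m)), (Rabs_pos_eq (r ^ n)), (Rabs_pos_eq (INR (S n)))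
    by (try apply Hp; apply pos_INR).
  assert (Hk : (1 <= INR (S n) ^ 2)%R).
  { rewrite S_INR. pose proof (pos_INR n). nra. }
  pose proof (Cmod_ge_0 Q) as HQ0. pose proof (Cmod_ge_0 q) as Hq0.
  assert (H1 : (Cmod q ^ m <= r ^ m)%R) by (apply pow_incr; lra).
  assert (Hq0m : (0 <= Cmod q ^ m)%R) by (apply pow_le; lra).
  assert (Hrm : (r ^ m <= 1)%R) by (rewrite <- (pow1 m); apply pow_incr; lra).
  assert (H2 : ((Cmod Q * Cmod q ^ m) ^ n <= r ^ n)%R) by (apply pow_incr; nra).
  assert (H2' : (0 <= (Cmod Q * Cmod q ^ m) ^ n)%R) by (apply pow_le; nra).
  assert (Hg : (0 <= Rabs (IZR (GV b)) / INR (S n) ^ 2 <= Rabs (IZR (GV b)))%R).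
  { pose proof (Rabs_pos (IZR (GV b))). split.
    - apply Rmult_le_pos; [lra|]. apply Rlt_le, Rinv_0_lt_compat. lra.
    - apply Rmult_le_reg_r with (INR (S n) ^ 2)%R; [lra|]. unfold Rdiv.
      rewrite Rmult_assoc, Rinv_l by lra. nra. }
  rewrite (Rmult_assoc (Rabs (IZR (GV b)))).
  apply Rmult_le_compat; [lra| |lra|].
  - apply Rmult_le_pos; [nra|exact H2'].
  - rewrite Rmult_assoc. apply Rmult_le_compat_l; [lra|].
    apply Rmult_le_compat; lra.
Qed.

(* Absolute summability near [w] bounds [|GV_b| e^(rho |t_b|) |Q'^b|]; as the [GV_b] are integers,
   all but finitely many [b] with [GV_b <> 0] then have [|Q'^b| <= 1/2] on a common disc. *)
Lemma convergent_near (w : C) (d : R) : (0 < d)%R ->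
  (Cmod (Cexp (dual_freq * w)) < 1)%R ->
  (forall b, (Cmod (Cexp (dual_freq * t b * w)) < 1)%R) ->
  (forall v, (Cmod (v - w)%C <= d)%R ->
    abs_summable (fun b => RtoC (IZR (GV b)) * Cexp (dual_freq * t b * v))) ->
  exists d', (0 < d')%R /\ forall v, (Cmod (v - w)%C <= d')%R -> convergent_at v.
Proof.
  intros Hd Hq HQ Hs.
  destruct (Cmod_Cexp_lt1_near _ _ Hq) as [d1 [Hd1 H1]].
  pose proof (abs_summable_exp_majorant _ _ w d Hd Hs) as HM.
  destruct (abs_summable_small _ (1 / 2) HM) as [s Hsmall]; [lra|]. clear HM.
  assert (Hfin : exists d2, (0 < d2)%R /\ forall b, In b s -> forall v, (Cmod (v - w)%C <= d2)%R ->
    (Cmod (Cexp (dual_freq * t b * v)) < 1)%R).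
  { clear Hsmall. induction s as [|b s [d2 [Hd2 H2]]]; [exists 1%R; split; [lra|intros b []]|].
    destruct (Cmod_Cexp_lt1_near _ _ (HQ b)) as [d3 [Hd3 H3]].
    exists (Rmin d2 d3). split; [apply Rmin_pos; assumption|].
    pose proof (Rmin_l d2 d3). pose proof (Rmin_r d2 d3).
    intros b' [<-|Hb] v Hv; [apply H3; lra|apply H2; [exact Hb|lra]]. }
  destruct Hfin as [d2 [Hd2 H2]].
  (* d / 2 is the rate in the spare factor of the majorant, which therefore absorbs the growth of
     |Q'^b| over this distance. *)
  exists (Rmin (Rmin d1 d2) (d / 2)). split; [repeat apply Rmin_pos; lra|].
  pose proof (Rmin_l (Rmin d1 d2) (d / 2)). pose proof (Rmin_r (Rmin d1 d2) (d / 2)).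
  pose proof (Rmin_l d1 d2). pose proof (Rmin_r d1 d2).
  intros v Hv. split; [apply H1; lra|]. split; [|apply Hs; lra].
  intros b Hb. destruct (classic (In b s)) as [Hin|Hin]; [apply (H2 b Hin); lra|].
  specialize (Hsmall b Hin). rewrite !Cmod_R in Hsmall.
  pose proof (Cmod_Cexp_near (dual_freq * t b) v w) as Hnear. rewrite (Cmod_Cexp (_ * w)) in Hnear.
  set (T := Cmod (dual_freq * t b)) in *. assert (HT : (0 <= T)%R) by apply Cmod_ge_0.
  assert (HGV : (1 <= Rabs (IZR (GV b)))%R) by (rewrite <- abs_IZR; apply IZR_le; lia).
  assert (He : (exp (Cmod (v - w)%C * T) <= exp (d * T / 2))%R) by (apply exp_le; nra).
  set (X := exp (Re (dual_freq * t b * w))) in *. assert (HX : (0 < X)%R) by apply exp_pos.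
  set (Y := exp (d * T / 2)) in *. assert (HY : (0 < Y)%R) by apply exp_pos.
  assert (HXY : (0 < X * Y)%R) by (apply Rmult_lt_0_compat; assumption).
  rewrite Rabs_pos_eq in Hsmall by (apply Rmult_le_pos; [apply Rmult_le_pos|]; lra).
  assert (X * exp (Cmod (v - w)%C * T) <= X * Y)%R by (apply Rmult_le_compat_l; lra).
  assert (X * Y <= Rabs (IZR (GV b)) * X * Y)%R by (rewrite Rmult_assoc; nra).
  lra.
Qed.

(** With z = i k epsilon / 2 one has q'^k = e^(2z), and the shift of t by 1/2 contributes exactly
    e^(-z). Dividing by the sine gives 2i Q'^(kb) / (e^(2z) - 1), that is -2i Q'^(kb) / (1 - q'^k),
    a geometric series in m. *)
Lemma F0_def_term_expansion (l : C) (b : B) (n : nat) : l <> 0 ->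
  (Cmod (Cexp (dual_freq * / l)) < 1)%R ->
  is_usum (fun m => - (2 * Ci) * prepot_term (/ l) (b, (m, n)))
    (F0_def_term GV (dual_epsilon l) (dual_t l t) b n).
Proof.
  intros Hl Hq.
  assert (Hqn : (Cmod (Cexp (dual_freq * / l) ^ S n) < 1)%R).
  { rewrite Cmod_pow. simpl. pose proof (Cmod_ge_0 (Cexp (dual_freq * / l))).
    assert (Cmod (Cexp (dual_freq * / l)) ^ n <= 1)%R by (rewrite <- (pow1 n); apply pow_incr; lra).
    assert (0 <= Cmod (Cexp (dual_freq * / l)) ^ n)%R by (apply pow_le; lra). nra. }
  pose proof (is_usum_scal _ (- (2 * Ci) * prepot_coef (b, (0%nat, n)) * Cexp (dual_freq * t b * / l) ^ S n) _
    (proj2 (is_usum_geom _ Hqn))) as H.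
  replace (F0_def_term GV (dual_epsilon l) (dual_t l t) b n) with
    (- (2 * Ci) * prepot_coef (b, (0%nat, n)) * Cexp (dual_freq * t b * / l) ^ S n *
      (1 / (1 - Cexp (dual_freq * / l) ^ S n))).
  - apply is_usum_ext with (2 := H). intros m. unfold prepot_term. rewrite Cexp_prepot_freq.
    unfold prepot_coef. simpl fst. simpl snd.
    rewrite Cpow_mult_l, <- !Cpow_mult_r, (Nat.mul_comm m). ring.
  - assert (Hne : 1 - Cexp (dual_freq * / l) ^ S n <> 0).
    { intros E. assert (E1 : Cexp (dual_freq * / l) ^ S n = 1)
        by (rewrite <- (Cplus_0_r (_ ^ _)), <- E; ring).
      rewrite E1, Cmod_1 in Hqn. lra. }
    unfold F0_def_term, Csin, prepot_coef. simpl fst. simpl snd.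
    pose proof (RtoC_INR_S_neq0 n) as Hk. set (k := RtoC (INR (S n))) in *.
    set (z := k * dual_freq * / l / 2).
    replace (Ci * (k * dual_epsilon l / 2)) with z.
    2: { unfold z, dual_epsilon, lambda_check, dual_freq. rewrite !RtoC_mult.
         field. repeat split; (exact Hl || exact RtoC_PI_neq0). }
    replace (Ce (k * dual_t l t b)) with (Cexp (dual_freq * t b * / l) ^ S n * Cexp (- z)).
    2: { rewrite <- Cexp_pow, <- Cexp_plus. unfold Ce. f_equal. fold k.
         unfold z, dual_t, lambda_check, dual_freq. rewrite !RtoC_mult.
         field. repeat split; (exact Hl || exact RtoC_PI_neq0). }
    assert (Hz : Cexp (dual_freq * / l) ^ S n = Cexp z * Cexp z).
    { rewrite <- Cexp_pow, <- Cexp_plus. f_equal. fold k. unfold z. field. exact Hl. }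
    rewrite Hz in *. rewrite (Cexp_opp z). pose proof (Cexp_neq0 z) as He. pose proof Ci_nz.
    set (e := Cexp z) in *.
    assert (e * e - 1 <> 0).
    { intros E. apply Hne. replace (1 - e * e) with (- (e * e - 1)) by ring. rewrite E. ring. }
    field. repeat split; assumption.
Qed.

Lemma F0_def_series_expansion (l : C) (b : B) : l <> 0 -> convergent_at (/ l) ->
  is_usum (F0_def_term GV (dual_epsilon l) (dual_t l t) b)
    (- (2 * Ci) * CSum_over (fun p => prepot_term (/ l) (b, p))).
Proof.
  intros Hl Hc. apply abs_summable_prepot in Hc as Ha.
  (* The geometric series runs over m at fixed n, so m must be the inner, second, component; hence
     the swap. *)
  apply (is_usum_fubini (fun p => - (2 * Ci) * prepot_term (/ l) (b, (snd p, fst p)))).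
  - apply is_usum_scal.
    apply (is_usum_bij (fun p : nat * nat => (snd p, fst p)) (fun p => (snd p, fst p))
      (fun p => prepot_term (/ l) (b, p))); [now intros []|now intros []|].
    apply CSum_over_correct, (abs_summable_inj (fun p => (b, p))), Ha. congruence.
  - intros n. apply F0_def_term_expansion; [exact Hl|apply Hc].
Qed.

Lemma F0_def_expansion (l : C) : l <> 0 -> convergent_at (/ l) ->
  is_usum (fun b => CSeries (F0_def_term GV (dual_epsilon l) (dual_t l t) b))
    (- (2 * Ci) * CSum_over (prepot_term (/ l))).
Proof.
  intros Hl Hc. apply abs_summable_prepot in Hc as Ha.
  apply is_usum_ext with (2 := is_usum_scal _ (- (2 * Ci)) _ (CSum_over_fubini _ Ha)).
  intros b. symmetry. apply CSeries_usum, F0_def_series_expansion; assumption.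
Qed.

Lemma lambda_F0_def_expansion (l : C) : l <> 0 -> convergent_at (/ l) ->
  lambda_F0_def GV t l = - Ci * l * CSum_over (prepot_term (/ l)).
Proof.
  intros Hl Hc. unfold lambda_F0_def, F0_def.
  rewrite (CSum_over_unique _ _ (F0_def_expansion l Hl Hc)). field.
Qed.

End Expansion.

(** * The derivative and its reordering *)

Section Derivative.
Context {B : Type} (GV : B -> Z) (t : B -> C).

Lemma is_derive_lambda_F0_def (l : C) (d : R) : l <> 0 -> (0 < d)%R ->
  (forall v, (Cmod (v - / l)%C <= d)%R -> convergent_at GV t v) ->
  abs_summable (fun i => prepot_coef GV i * prepot_freq t i * Cexp (prepot_freq t i * / l)) /\
  is_derive (K := C_AbsRing) (V := C_NormedModule) (lambda_F0_def GV t) l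
    (- Ci * (CSum_over (prepot_term GV t (/ l)) -
      / l * CSum_over (fun i => prepot_coef GV i * prepot_freq t i * Cexp (prepot_freq t i * / l)))).
Proof.
  intros Hl Hd Hc.
  destruct (is_usum_derive (prepot_coef GV) (prepot_freq t)
    (fun v => CSum_over (prepot_term GV t v)) (/ l) d Hd) as [Ha Hder].
  { intros v Hv. apply abs_summable_prepot, Hc, Hv. }
  { intros v Hv. apply CSum_over_correct, abs_summable_prepot, Hc, Hv. }
  split; [exact Ha|].
  specialize (Hder _ (CSum_over_correct _ Ha)).
  set (D1 := CSum_over (fun i => prepot_coef GV i * prepot_freq t i * Cexp (prepot_freq t i * / l))) in *.
  pose proof (is_derive_comp (K := C_AbsRing) (V := C_NormedModule)
    (fun v => CSum_over (prepot_term GV t v)) Cinv l _ _ Hder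
    (proj1 (is_derive_C_AbsRing _ _ _) (is_derive_Cinv l Hl))) as H1.
  assert (H0 : is_derive (K := C_AbsRing) (V := C_NormedModule) (fun x : C => - Ci * x) l (- Ci)).
  { apply (is_derive_quadratic _ _ _ 0 1); [lra|]. intros h _.
    replace (- Ci * (l + h) - - Ci * l - h * - Ci) with (RtoC 0) by ring. rewrite Cmod_0. lra. }
  pose proof (is_derive_mult (K := C_AbsRing) _ _ l _ _
    (proj1 (is_derive_C_AbsRing _ _ _) H0) (proj1 (is_derive_C_AbsRing _ _ _) H1) Cmult_comm) as H2.
  (* The expansion is available only where 1 / y stays in the disc around 1 / l, which suffices for
     a derivative. *)
  destruct (Cinv_near l d Hl Hd) as [d' [Hd' Hnear]].
  apply (is_derive_ext_loc (K := C_AbsRing) (V := C_NormedModule)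
    (fun x => (- Ci * x) * CSum_over (prepot_term GV t (/ x)))).
  - exists (mkposreal _ Hd'). intros y Hy.
    change (Cmod (y - l) < d')%R in Hy. destruct (Hnear y) as [Hy0 Hy1]; [lra|].
    symmetry. apply lambda_F0_def_expansion; [exact Hy0|apply Hc; lra].
  - match type of H2 with is_derive _ _ ?x => match goal with |- is_derive _ _ ?y =>
      replace y with x; [apply is_derive_C_AbsRing; exact H2|] end end.
    change (- Ci * CSum_over (prepot_term GV t (/ l)) + - Ci * l * (- / (l * l) * D1) =
      - Ci * (CSum_over (prepot_term GV t (/ l)) - / l * D1)).
    field. exact Hl.
Qed.

(** The exponent read off from the factor: a logarithm of it, which need not be the principal
    one. *)
Definition log_Z_factor (l : C) (b : B) (m : nat) : C :=
  let x := Q' l t b * q' l ^ m in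
  - (RtoC (IZR (GV b)) / (2 * RtoC PI * Ci)) * Li2 x +
  - (RtoC (IZR (GV b)) / lambda_check l) * (t b + RtoC (INR m)) * Clog (1 - x).

Lemma Z_factor_Cexp (l : C) (b : B) (m : nat) :
  Z_factor GV l t b m = Cexp (log_Z_factor l b m).
Proof. unfold Z_factor, log_Z_factor, Cpower. now rewrite <- Cexp_plus. Qed.

Lemma is_usum_Li2 (x : C) : (Cmod x < 1)%R ->
  is_usum (fun n => x ^ S n / RtoC (INR (S n)) ^ 2) (Li2 x).
Proof.
  intros Hx.
  assert (Ha : abs_summable (fun n => x ^ S n / RtoC (INR (S n)) ^ 2)).
  { apply (abs_summable_le _ _ 1) with (2 := abs_summable_log_series x Hx). intros n.
    pose proof (RtoC_INR_S_neq0 n) as Hn.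
    replace (x ^ S n / RtoC (INR (S n)) ^ 2) with (x ^ S n / RtoC (INR (S n)) * / RtoC (INR (S n)))
      by (field; exact Hn).
    rewrite Cmod_mult, Rmult_comm.
    apply Rmult_le_compat_r; [apply Cmod_ge_0|].
    rewrite Cmod_inv, Cmod_R by exact Hn.
    assert (1 <= INR (S n))%R by (rewrite S_INR; pose proof (pos_INR n); lra).
    rewrite Rabs_pos_eq, <- Rinv_1 by lra. apply Rinv_le_contravar; lra. }
  destruct (abs_summable_usum _ Ha) as [S HS].
  unfold Li2. now rewrite (CSeries_usum _ _ HS).
Qed.

(** The operator (i / 2 pi) (1 - w d/dw) applied to [prepot_term]; the constant is the product of -1
    / (2 pi) from [F_top_sg] and -i from the expansion. *)
Definition F_top_term (w : C) (i : B * (nat * nat)) : C :=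
  Ci / (2 * RtoC PI) * (prepot_term GV t w i +
    - w * (prepot_coef GV i * prepot_freq t i * Cexp (prepot_freq t i * w))).

Lemma is_usum_log_Z_factor (l : C) (b : B) (m : nat) : l <> 0 ->
  (Cmod (q' l) < 1)%R -> (Cmod (Q' l t b) < 1)%R ->
  is_usum (fun n => F_top_term (/ l) (b, (m, n))) (log_Z_factor l b m).
Proof.
  intros Hl Hq HQ. unfold log_Z_factor. set (x := Q' l t b * q' l ^ m).
  assert (Hx : (Cmod x < 1)%R).
  { unfold x. rewrite Cmod_mult, Cmod_pow.
    pose proof (Cmod_ge_0 (q' l)). pose proof (Cmod_ge_0 (Q' l t b)).
    assert (0 <= Cmod (q' l) ^ m)%R by (apply pow_le; lra).
    assert (Cmod (q' l) ^ m <= 1)%R by (rewrite <- (pow1 m); apply pow_incr; lra). nra. }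
  pose proof RtoC_PI_neq0 as HPI.
  assert (HCi : / Ci = - Ci).
  { transitivity (- (Ci * Ci) * / Ci); [|field; apply Ci_nz].
    replace (Ci * Ci) with (- (1)) by (apply injective_projections; simpl; ring). ring. }
  pose proof (is_usum_plus _ _ _ _
    (is_usum_scal _ (- (RtoC (IZR (GV b)) / (2 * RtoC PI * Ci))) _ (is_usum_Li2 x Hx))
    (is_usum_scal _ (RtoC (IZR (GV b)) / lambda_check l * (t b + RtoC (INR m))) _ (is_usum_log x Hx))) as H.
  match type of H with is_usum _ ?u => match goal with |- is_usum _ ?v => replace v with u by ring end end.
  apply is_usum_ext with (2 := H). intros n.
  unfold F_top_term, prepot_term. rewrite Cexp_prepot_freq.
  rewrite <- Q'_Cexp, <- q'_Cexp by exact Hl. fold x.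
  unfold prepot_coef, prepot_freq, lambda_check, dual_freq. simpl fst. simpl snd.
  pose proof (RtoC_INR_S_neq0 n) as Hk. set (k := RtoC (INR (S n))) in *.
  rewrite !RtoC_mult.
  replace (RtoC (IZR (GV b)) / (2 * RtoC PI * Ci)) with (- Ci * (RtoC (IZR (GV b)) / (2 * RtoC PI))).
  2: { rewrite <- HCi. field. split; [apply Ci_nz|exact HPI]. }
  set (y := x ^ S n). set (g := RtoC (IZR (GV b))). set (T := t b + RtoC (INR m)).
  (* [field] treats [Ci] as an indeterminate, so its square is isolated and evaluated by hand. *)
  transitivity (Ci / (2 * RtoC PI) * (g / k ^ 2 * y) +
    - (Ci * Ci) * (2 * RtoC PI * / l * (g / k * T * y))).
  - replace (Ci * Ci) with (- (1)) by (apply injective_projections; simpl; ring).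
    field. auto.
  - field. auto.
Qed.

End Derivative.

Theorem proposition4p4 (B : Type) (GV : B -> Z) (lambda : C) (t : B -> C)
  (lambda_neq0 : lambda <> 0)
  (q'_lt1 : (Cmod (q' lambda) < 1)%R)
  (Q'_lt1 : forall b : B, (Cmod (Q' lambda t b) < 1)%R)
  (GV_summable : locally (T := C_UniformSpace) lambda (fun l : C =>
     abs_summable (fun b : B => RtoC (IZR (GV b)) * Q' l t b))) :
  (forall b : B, ex_CProd (Z_factor GV lambda t b)) /\
  ex_CProd_over (fun b : B => CProd (Z_factor GV lambda t b)) /\
  locally (T := C_UniformSpace) lambda (fun l : C =>
    (forall b : B, ex_series (V := C_NormedModule) (F0_def_term GV (dual_epsilon l) (dual_t l t) b)) /\
    ex_CSum_over (fun b : B => CSeries (F0_def_term GV (dual_epsilon l) (dual_t l t) b))) /\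
  ex_derive (lambda_F0_def GV t) lambda /\
  Z_top_sg GV lambda t = Cexp (F_top_sg GV lambda t).
Proof.
  rename lambda_neq0 into Hl. set (w := / lambda).
  assert (Hw : w <> 0).
  { intros E. apply C1_nz. rewrite <- (Cinv_r lambda Hl). fold w. rewrite E. ring. }
  assert (Hww : / w = lambda) by (unfold w; field; auto using C1_nz).
  assert (Hconv : exists d, (0 < d)%R /\ forall v, (Cmod (v - w)%C <= d)%R -> convergent_at GV t v).
  { apply locally_Cmod in GV_summable. destruct GV_summable as [e [He Hsum]].
    destruct (Cinv_near w e Hw He) as [d [Hd Hnear]].
    apply (convergent_near GV t w d Hd).
    - unfold w. rewrite <- q'_Cexp by exact Hl. exact q'_lt1.
    - intros b. unfold w. rewrite <- Q'_Cexp by exact Hl. apply Q'_lt1.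
    - intros v Hv. destruct (Hnear v Hv) as [Hv0 Hv1]. rewrite Hww in Hv1.
      assert (Hiv : / v <> 0).
      { intros E. apply C1_nz. rewrite <- (Cinv_r v Hv0), E. ring. }
      specialize (Hsum (/ v) Hv1).
      (* The hypothesis lives near lambda and is read at 1 / v, where [Q'] is the required
         exponential in v. *)
      apply (abs_summable_le _ _ 1) with (2 := Hsum). intros b.
      rewrite Q'_Cexp by exact Hiv. replace (/ / v) with v by (field; auto using C1_nz). lra. }
  destruct Hconv as [d [Hd Hconv]].
  destruct (is_derive_lambda_F0_def GV t lambda d Hl Hd Hconv) as [Ha Hder].
  assert (Hc : convergent_at GV t w)
    by (apply Hconv; replace (w - w) with (RtoC 0) by ring; rewrite Cmod_0; lra).
  assert (HF : abs_summable (F_top_term GV t w) /\ is_usum (F_top_term GV t w) (F_top_sg GV lambda t)).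
  { apply abs_summable_prepot in Hc. split.
    - apply (abs_summable_le _ _ (Cmod (Ci / (2 * RtoC PI)) * (1 + Cmod w)))
        with (2 := abs_summable_plus _ _ Hc Ha).
      intros i. unfold F_top_term. fold w. rewrite Cmod_mult, Rmult_assoc.
      apply Rmult_le_compat_l; [apply Cmod_ge_0|].
      eapply Rle_trans; [apply Cmod_triangle|]. rewrite (Cmod_mult (- w)), Cmod_opp.
      set (X := Cmod (prepot_term GV t w i)).
      set (Y := Cmod (prepot_coef GV i * prepot_freq t i * Cexp (prepot_freq t i * w))).
      assert (HX : (0 <= X)%R) by apply Cmod_ge_0. assert (HY : (0 <= Y)%R) by apply Cmod_ge_0.
      pose proof (Cmod_ge_0 w). rewrite Cmod_R, Rabs_pos_eq by lra. nra.
    - replace (F_top_sg GV lambda t) with (Ci / (2 * RtoC PI) * (CSum_over (prepot_term GV t w) +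
        - w * CSum_over (fun i => prepot_coef GV i * prepot_freq t i * Cexp (prepot_freq t i * w)))).
      + apply is_usum_scal, is_usum_plus; [|apply is_usum_scal]; apply CSum_over_correct; assumption.
      + unfold F_top_sg. rewrite (is_C_derive_unique _ _ _ Hder). fold w. field. exact RtoC_PI_neq0. }
  destruct HF as [HFa HF].
  assert (HFb : forall b, abs_summable (fun p => F_top_term GV t w (b, p)))
    by (intros b; apply (abs_summable_inj (fun p => (b, p))), HFa; congruence).
  (* [V b] is a logarithm of the inner product over m. Absolute summability over triples lets it be
     summed with n innermost and then m, and the [V b] in turn over b. *)
  set (V := fun b => CSum_over (fun p => F_top_term GV t w (b, p))).
  assert (HV : forall b, is_usum (log_Z_factor GV t lambda b) (V b)).
  { intros b. apply (is_usum_fubini (fun p => F_top_term GV t w (b, p))).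
    - apply CSum_over_correct, HFb.
    - intros m. apply is_usum_log_Z_factor; auto. }
  assert (HZ : forall b, filterlim (Cprod_upto (Z_factor GV lambda t b)) eventually
    (locally (T := C_UniformSpace) (Cexp (V b)))).
  { intros b. apply filterlim_ext with (Cprod_upto (fun m => Cexp (log_Z_factor GV t lambda b m))).
    - intros n. induction n as [|n IH]; [reflexivity|]. simpl. now rewrite IH, Z_factor_Cexp.
    - apply is_usum_Cprod_upto; [apply HV|apply Cexp_0|apply Cexp_plus|apply continuous_Cexp]. }
  assert (HP : filterlim (Cprod_list (fun b => CProd (Z_factor GV lambda t b))) (finsets B)
    (locally (T := C_UniformSpace) (Cexp (F_top_sg GV lambda t)))).
  { apply filterlim_ext with (Cprod_list (fun b => Cexp (V b))).
    - intros s. unfold Cprod_list. f_equal. apply map_ext. intros b. symmetry.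
      apply (Clim_along_unique eventually), HZ.
    - apply is_usum_Cprod_list; [|apply Cexp_0|apply Cexp_plus|apply continuous_Cexp].
      apply (is_usum_fubini (F_top_term GV t w) _ _ HF). intros b. apply CSum_over_correct, HFb. }
  split; [|split; [|split; [|split]]].
  - intros b. exists (Cexp (V b)). apply HZ.
  - exists (Cexp (F_top_sg GV lambda t)). exact HP.
  - destruct (Cinv_near lambda d Hl Hd) as [d' [Hd' Hnear]].
    apply locally_Cmod. exists d'. split; [exact Hd'|]. intros y Hy.
    destruct (Hnear y) as [Hy0 Hy1]; [lra|].
    assert (Hcy : convergent_at GV t (/ y)) by (apply Hconv; unfold w; lra).
    split.
    + intros b. eexists. apply is_usum_series, F0_def_series_expansion; assumption.
    + eexists. apply F0_def_expansion; assumption.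
  - eexists. exact Hder.
  - apply Clim_along_unique; [typeclasses eauto|exact HP].
Qed.
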